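(* Let $p$ be a prime and let $\mathcal{F}$ be a saturated fusion system over the finite $p$-group $S$. If the restriction map $H^1(\mathcal{F};\mathbb{F}_p)\to H^1(S;\mathbb{F}_p)$ is an isomorphism, then $\mathcal{F}=\mathcal{F}_S(S)$.
   Context: Fusion systems over finite $p$-groups are in the sense of Puig and Broto–Levi–Oliver: objects are the subgroups of $S$, morphisms are certain injective homomorphisms including those induced by conjugation in $S$, subject to the saturation axioms. $H^*(\mathcal{F};\mathbb{F}_p)=\{z\in H^*(S;\mathbb{F}_p)\mid \operatorname{res}(z)=\varphi^*(z)\text{ for each }P\le S,\ \varphi\in\operatorname{Hom}_{\mathcal{F}}(P,S)\}$, where $\operatorname{res}$ is restriction to $H^*(P;\mathbb{F}_p)$; the restriction map $H^*(\mathcal{F};\mathbb{F}_p)\to H^*(S;\mathbb{F}_p)$ is the inclusion of this subring. $\mathcal{F}_S(S)$ is the fusion system over $S$ whose morphisms are exactly the homomorphisms induced by conjugation by elements of $S$. *)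

(* Defs.v *)
From HB Require Import structures.
From mathcomp Require Import all_boot all_order all_algebra all_fingroup.
From mathcomp Require Import all_solvable.

Set Implicit Arguments.
Unset Strict Implicit.
Unset Printing Implicit Defensive.

Import GRing.Theory GroupScope.

(******************************************************************************)
(* Fusion systems, after Broto-Levi-Oliver.                                   *)
(* A homomorphism defined on a subgroup P <= S is represented by a function   *)
(* gT -> gT of which only the values on P matter.                             *)
(******************************************************************************)

Section FusionSystems.

Variable gT : finGroupType.
Implicit Types (S P Q R N : {group gT}) (f g : gT -> gT).

Definition homsets := {group gT} -> {group gT} -> pred (gT -> gT).

Definition fiso (H : homsets) P Q f : Prop :=
  H P Q f /\ exists g, [/\ H Q P g, {in P, cancel f g} & {in Q, cancel g f}].

(* Hom_S(P, Q) *)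
Definition conj_homs S : homsets := fun P Q f =>
  [&& P \subset S, Q \subset S
    & [exists s in S, (P :^ s \subset Q) && [forall x in P, f x == x ^ s]]].

Record fusion_system S := FusionSystem {
  fhom :> {group gT} -> {group gT} -> pred (gT -> gT);
  fhom_eq_in : forall P Q f g, {in P, f =1 g} -> fhom P Q f = fhom P Q g;
  fhom_obj : forall P Q f, fhom P Q f -> P \subset S /\ Q \subset S;
  fhom_comp : forall P Q R f g, fhom P Q f -> fhom Q R g -> fhom P R (g \o f);
  (* Hom_S(P, Q) <= Hom_F(P, Q) <= Inj(P, Q) *)
  fhom_conj : forall P Q f, conj_homs S P Q f -> fhom P Q f;
  fhom_inj : forall P Q f, fhom P Q f ->
    [/\ {in P &, {morph f : x y / x * y}}, {in P &, injective f}
      & f @: P \subset Q];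
  (* every morphism is an isomorphism followed by an inclusion *)
  fhom_factor : forall P Q f, fhom P Q f ->
    exists2 R : {group gT}, R = f @: P :> {set gT} & fiso fhom P R f
}.

Lemma conj_homsP S P Q f :
  reflect [/\ P \subset S, Q \subset S
            & exists2 s, s \in S & P :^ s \subset Q /\ {in P, f =1 conjg^~ s}]
          (conj_homs S P Q f).
Proof.
apply: (iffP and3P) => [[sPS sQS /exists_inP[s Ss /andP[sPQ /eqfun_inP eqf]]]|].
  by split=> //; exists s.
case=> sPS sQS [s Ss [sPQ eqf]]; split=> //; apply/exists_inP; exists s => //.
by rewrite sPQ; apply/eqfun_inP.
Qed.

Section ConjFusion.

Variable S : {group gT}.

Lemma conj_homs_eq_in P Q f g :
  {in P, f =1 g} -> conj_homs S P Q f = conj_homs S P Q g.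
Proof.
move=> eqfg; rewrite /conj_homs; congr [&& _, _ & _].
apply: eq_existsb => s; congr [&& _, _ & _].
by apply: eq_forallb_in => x Px; rewrite eqfg.
Qed.

Lemma conj_homs_obj P Q f : conj_homs S P Q f -> P \subset S /\ Q \subset S.
Proof. by case/and3P. Qed.

Lemma conj_homs_comp P Q R f g :
  conj_homs S P Q f -> conj_homs S Q R g -> conj_homs S P R (g \o f).
Proof.
case/conj_homsP=> sPS _ [s Ss [sPQ eqf]].
case/conj_homsP=> _ sRS [t St [sQR eqg]].
apply/conj_homsP; split=> //; exists (s * t); rewrite ?groupM //; split.
  by rewrite conjsgM (subset_trans _ sQR) // conjSg.
move=> x Px /=; rewrite eqf // eqg ?conjgM //.
by rewrite (subsetP sPQ) // memJ_conjg.
Qed.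

Lemma conj_homs_inj P Q f : conj_homs S P Q f ->
  [/\ {in P &, {morph f : x y / x * y}}, {in P &, injective f}
    & f @: P \subset Q].
Proof.
case/conj_homsP=> _ _ [s _ [sPQ eqf]]; split.
- by move=> x y Px Py; rewrite !eqf ?groupM // conjMg.
- by move=> x y Px Py; rewrite !eqf //; apply: conjg_inj.
apply/subsetP=> _ /imsetP[x Px ->].
by rewrite eqf // (subsetP sPQ) // memJ_conjg.
Qed.

Lemma conj_homs_factor P Q f : conj_homs S P Q f ->
  exists2 R : {group gT}, R = f @: P :> {set gT} & fiso (conj_homs S) P R f.
Proof.
case/conj_homsP=> sPS _ [s Ss [sPQ eqf]].
have sPsS: P :^ s \subset S by rewrite -(conjGid Ss) conjSg.
exists (P :^ s)%G; first by rewrite /= /conjugate; apply: eq_in_imset => x /eqf.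
split; first by apply/conj_homsP; split=> //; exists s.
exists (conjg^~ s^-1); split.
- apply/conj_homsP; split=> //; exists s^-1; rewrite ?groupV //.
  by rewrite /= conjsgK.
- by move=> x Px; rewrite eqf // conjgK.
by move=> _ /imsetP[x Px ->]; rewrite conjgK eqf.
Qed.

(* F_S(S) *)
Definition conj_fusion : fusion_system S :=
  @FusionSystem S (conj_homs S) conj_homs_eq_in conj_homs_obj conj_homs_comp
    (fun P Q f => id) conj_homs_inj conj_homs_factor.

End ConjFusion.

(* Equality of fusion systems over S as categories; Leibniz equality of the   *)
(* records would also compare the proofs and the representing functions.      *)
Definition eq_fusion S (F G : fusion_system S) : Prop :=
  forall P Q, F P Q =1 G P Q.

Section Saturation.

Variables (S : {group gT}) (F : fusion_system S).

Definition fconj P Q : Prop := exists f, fiso F P Q f.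

Definition fully_centralized P : Prop :=
  P \subset S /\ forall Q, fconj P Q -> #|'C_S(Q)| <= #|'C_S(P)|.

Definition fully_normalized P : Prop :=
  P \subset S /\ forall Q, fconj P Q -> #|'N_S(Q)| <= #|'N_S(P)|.

(* Aut_F(P); in particular Aut_S(P) is faut (conj_fusion S) P *)
Definition faut (E : fusion_system S) P : {set {perm gT}} :=
  [set a in Aut P | E P P a].

(* N_f = {g in N_S(P) | f c_g f^-1 in Aut_S(f(P))}, where f c_g f^-1 = c_h on *)
(* f(P) means that f(x ^ g) = f(x) ^ h for all x in P.                        *)
Definition ext_dom P f : {set gT} :=
  [set g in 'N_S(P) |
    [exists h in 'N_S(f @: P), [forall x in P, f (x ^ g) == f x ^ h]]].

Definition saturated (p : nat) : Prop :=
  (forall P, fully_normalized P ->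
     fully_centralized P /\ p.-Sylow(faut F P) (faut (conj_fusion S) P))
  /\
  (forall P Q f, F P S f -> Q = f @: P :> {set gT} -> fully_centralized Q ->
     exists2 N : {group gT}, N = ext_dom P f :> {set gT}
              & exists2 g, F N S g & {in P, g =1 f}).

End Saturation.

End FusionSystems.

(******************************************************************************)
(* Mod p cohomology of a finite group, computed from the homogeneous standard *)
(* resolution: H^n(G; F_p) is the n-th cohomology of the complex of functions *)
(* c : G^(n+1) -> F_p such that c(x g_0, ..., x g_n) = c(g_0, ..., g_n).      *)
(******************************************************************************)

Section Cohomology.

Local Open Scope ring_scope.

Variable p : nat.

Definition cochain (gT : finGroupType) n :=
  {ffun {ffun 'I_n.+1 -> gT} -> 'F_p}.

Section Group.

Variable gT : finGroupType.

Definition invariant n (c : cochain gT n) : bool :=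
  [forall x : gT, forall g : {ffun 'I_n.+1 -> gT}, c [ffun i => (x * g i)%g] == c g].

Definition differential n (c : cochain gT n) : cochain gT n.+1 :=
  [ffun g : {ffun 'I_n.+2 -> gT} =>
    \sum_(i < n.+2) (-1) ^+ i * c [ffun j => g (lift i j)]].

Definition is_cocycle n : pred (cochain gT n) :=
  fun c => invariant c && (differential c == 0).
Arguments is_cocycle : clear implicits.

Definition is_coboundary n : pred (cochain gT n) :=
  match n with
  | 0 => pred1 0
  | m.+1 => fun c => [exists b : cochain gT m, invariant b && (c == differential b)]
  end.
Arguments is_coboundary : clear implicits.

Lemma differential_is_zmod_morphism n : zmod_morphism (@differential n).
Proof.
move=> c d; apply/ffunP=> g; rewrite !ffunE -sumrB.
by apply: eq_bigr => i _; rewrite !ffunE mulrBr.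
Qed.

HB.instance Definition _ n :=
  GRing.isZmodMorphism.Build (cochain gT n) (cochain gT n.+1) (@differential n)
    (@differential_is_zmod_morphism n).

Lemma invariantB n (c d : cochain gT n) :
  invariant c -> invariant d -> invariant (c - d).
Proof.
move=> /forallP-ic /forallP-id; apply/forallP=> x; apply/forallP=> g.
by rewrite !ffunE (eqP (forallP (ic x) g)) (eqP (forallP (id x) g)).
Qed.

Lemma invariant0 n : invariant (0 : cochain gT n).
Proof. by apply/forallP=> x; apply/forallP=> g; rewrite !ffunE. Qed.

Lemma is_cocycle_closed n : zmod_closed (is_cocycle n).
Proof.
split=> [|c d /andP[ic /eqP dc0] /andP[id /eqP dd0]]; apply/andP.
  by rewrite invariant0 raddf0.
by rewrite invariantB // raddfB /= dc0 dd0 subrr.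
Qed.

HB.instance Definition _ n :=
  GRing.isZmodClosed.Build (cochain gT n) (is_cocycle n) (is_cocycle_closed n).

Record cocycle n := Cocycle {
  cocycle_val : cochain gT n;
  _ : cocycle_val \in is_cocycle n }.

HB.instance Definition _ n := [isSub for @cocycle_val n].
HB.instance Definition _ n := [Choice of cocycle n by <:].
HB.instance Definition _ n := [SubChoice_isSubZmodule of cocycle n by <:].

Definition coboundary n : pred (cocycle n) :=
  fun z => is_coboundary n (val z).
Arguments coboundary : clear implicits.

Lemma coboundary_closed n : zmod_closed (coboundary n).
Proof.
have cbE c : (c \in coboundary n) = is_coboundary n (val c) by [].
split=> [|c d]; rewrite !cbE ?raddf0 ?raddfB /=.
  case: n {cbE} => [|n] /=; first exact: eqxx.
  by apply/existsP; exists 0; rewrite invariant0 raddf0 /=.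
move: (cocycle_val c) (cocycle_val d) => a b; case: n {c d cbE} a b => [|n] c d /=.
  by move=> /eqP-> /eqP->; rewrite subrr.
move=> /existsP[b /andP[ib /eqP->]] /existsP[e /andP[ie /eqP->]].
by apply/existsP; exists (b - e); rewrite invariantB //= raddfB.
Qed.

HB.instance Definition _ n :=
  GRing.isZmodClosed.Build (cocycle n) (coboundary n) (coboundary_closed n).

Definition cohomology n : Type :=
  Quotient.quot (GRing.ZmodClosed.clone (cocycle n) (coboundary n) _).

HB.instance Definition _ n := GRing.Zmodule.on (cohomology n).
HB.instance Definition _ n := EqQuotient.on (cohomology n).

End Group.

Definition cochain_pull (aT rT : finGroupType) n (f : aT -> rT)
    (c : cochain rT n) : cochain aT n :=
  [ffun g : {ffun 'I_n.+1 -> aT} => c [ffun i => f (g i)]].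

(* The map f^* in cohomology. When f is a homomorphism, pullbacks of cocycles *)
(* are cocycles, so the default value 0 of insubd is not used: see            *)
(* cohomology_pull_pi.                                                        *)
Definition cohomology_pull (aT rT : finGroupType) n (f : aT -> rT)
    (z : cohomology rT n) : cohomology aT n :=
  \pi_(cohomology aT n)%qT
    (insubd 0 (cochain_pull f (val (generic_quotient.repr z)))).

Section PullTheory.

Variables (aT rT : finGroupType) (f : aT -> rT).
Hypothesis fM : {morph f : x y / (x * y)%g}.

Lemma cochain_pull_invariant n (c : cochain rT n) :
  invariant c -> invariant (cochain_pull f c).
Proof.
move=> /forallP-ic; apply/forallP=> x; apply/forallP=> g; rewrite !ffunE.
rewrite -(eqP (forallP (ic (f x)) [ffun i => f (g i)])); apply/eqP; congr (c _).
by apply/ffunP=> i; rewrite !ffunE fM.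
Qed.

Lemma cochain_pull_differential n (c : cochain rT n) :
  differential (cochain_pull f c) = cochain_pull f (differential c).
Proof.
apply/ffunP=> g; rewrite !ffunE; apply: eq_bigr => i _; rewrite !ffunE.
by congr (_ * _); congr (c _); apply/ffunP=> j; rewrite !ffunE.
Qed.

Lemma cochain_pullB n (c d : cochain rT n) :
  cochain_pull f (c - d) = cochain_pull f c - cochain_pull f d.
Proof. by apply/ffunP=> g; rewrite !ffunE. Qed.

Lemma cochain_pull0 n : cochain_pull f (0 : cochain rT n) = 0.
Proof. by apply/ffunP=> g; rewrite !ffunE. Qed.

Lemma cochain_pull_cocycle n (c : cocycle rT n) :
  cochain_pull f (val c) \in @is_cocycle aT n.
Proof.
have /andP[ic /eqP dc] := valP c; apply/andP; split.
  exact: cochain_pull_invariant.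
by rewrite cochain_pull_differential dc cochain_pull0.
Qed.

Lemma cohomology_pull_pi n (c : cocycle rT n) :
  cohomology_pull f (\pi_(cohomology rT n)%qT c)
  = \pi_(cohomology aT n)%qT (Cocycle (cochain_pull_cocycle c)).
Proof.
rewrite /cohomology_pull; set c' := generic_quotient.repr _.
have /eqP : c' = c %[mod cohomology rT n]%qT by rewrite reprK.
rewrite -Quotient.idealrBE => Bcc'; apply/eqP; rewrite -Quotient.idealrBE.
rewrite unfold_in /coboundary raddfB /= val_insubd cochain_pull_cocycle.
rewrite -cochain_pullB; move: Bcc'; rewrite unfold_in /coboundary raddfB /=.
move: (cocycle_val c') (cocycle_val c) => a b; case: n {c c'} a b => [|n] a b /=.
  by move=> /eqP->; rewrite cochain_pull0.
case/existsP=> d /andP[id /eqP->]; apply/existsP; exists (cochain_pull f d).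
by rewrite cochain_pull_invariant // cochain_pull_differential /=.
Qed.

End PullTheory.

Section Stable.

Variables (gT : finGroupType) (S : {group gT}) (F : fusion_system S) (n : nat).

Definition hom_to (P : {group gT}) (f : gT -> gT) : subg_of P -> subg_of S :=
  fun x => subg S (f (sgval x)).

Definition stable (z : cohomology (subg_of S) n) : Prop :=
  forall (P : {group gT}) (f : gT -> gT), F P S f ->
    cohomology_pull (@hom_to P id) z = cohomology_pull (@hom_to P f) z.

(* H^n(F; F_p) *)
Definition fusion_cohomology := {z : cohomology (subg_of S) n | stable z}.

(* the inclusion H^n(F; F_p) -> H^n(S; F_p) *)
Definition fusion_res (z : fusion_cohomology) : cohomology (subg_of S) n :=
  sval z.

End Stable.

End Cohomology.

(* Main.v *)
Require Import Defs.
From mathcomp Require Import all_boot all_order all_algebra all_fingroup.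
From mathcomp Require Import all_solvable.

(* Surjectivity of the restriction map says that every homomorphism S -> F_p
   is invariant under F, so x^-1 f(x) lies in Phi(S) for all f in F.  Call a
   normal subgroup K of S residual if every automorphism in F of prime power
   order prime to p acts trivially modulo K; by Alperin's argument F then agrees
   with S-conjugation modulo K.  Phi(S) is residual, and the point is to descend
   from a residual K <= Phi(S), K <> 1, to a residual M < K with K/M = F_p central
   in S/M.

   Let chi : K -> K/M = F_p.  For h in Hom_F(R, S) with image Q, choose s with
   h(w) = w^s modulo K.  Then lam(h(w)) = chi(h(w)^-1 w^s) is a homomorphism on
   Q, whereas chi itself is defined on Q :&: K only, where lam = chi h^-1 - chi.
   The transfer of lam to S is a homomorphism S -> F_p, so it vanishes on K:
   on K, the transfer of chi h^-1 is |S : Q| chi.  Summing over the orbits of an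
   F-stable virtual (S, S)-biset X of degree prime to p (a characteristic biset in
   the sense of Broto, Levi and Oliver), the left-hand sides add up to an
   F-invariant function, so chi is F-invariant.  An automorphism a of order prime
   to p then satisfies #[a] chi(x^-1 a(x)) = 0, whence x^-1 a(x) lies in M. *)

Set Implicit Arguments.
Unset Strict Implicit.
Unset Printing Implicit Defensive.

Import GRing.Theory GroupScope.

(** * Morphisms of a fusion system *)

Section FusionBasics.

Variables (gT : finGroupType) (S : {group gT}) (F : fusion_system S).
Implicit Types (P Q R : {group gT}) (f g : gT -> gT).

Lemma fhomM P Q f : F P Q f -> {in P &, {morph f : x y / x * y}}.
Proof. by case/fhom_inj. Qed.

Lemma fhom_injective P Q f : F P Q f -> {in P &, injective f}.
Proof. by case/fhom_inj. Qed.

Lemma fhom_im P Q f : F P Q f -> f @: P \subset Q.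
Proof. by case/fhom_inj. Qed.

Lemma fhom_mem P Q f x : F P Q f -> x \in P -> f x \in Q.
Proof. by move=> /fhom_im/subsetP-sfQ Px; apply/sfQ/imset_f. Qed.

Lemma fhom_dom P Q f : F P Q f -> P \subset S.
Proof. by case/fhom_obj. Qed.

Lemma fhom_cod P Q f : F P Q f -> Q \subset S.
Proof. by case/fhom_obj. Qed.

Lemma fhom_incl P Q : P \subset Q -> Q \subset S -> F P Q id.
Proof.
move=> sPQ sQS; apply/fhom_conj/conj_homsP.
split; rewrite ?(subset_trans sPQ) //; exists 1 => //.
by split; [rewrite conjsg1 | move=> x _; rewrite conjg1].
Qed.

Lemma fhom_restr P R Q f : R \subset P -> F P Q f -> F R Q f.
Proof. by move=> sRP Ff; apply: (fhom_comp (fhom_incl sRP (fhom_dom Ff)) Ff). Qed.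

Lemma fhom_corestr P Q R f :
  F P Q f -> f @: P \subset R -> R \subset S -> F P R f.
Proof.
case/fhom_factor=> R0 defR0 [Ff _] sfR sRS.
by apply: (fhom_comp Ff (fhom_incl _ sRS)); rewrite defR0.
Qed.

Lemma fhomS P Q f : F P Q f -> F P S f.
Proof.
move=> Ff; apply: (fhom_corestr Ff) => //.
exact: subset_trans (fhom_im Ff) (fhom_cod Ff).
Qed.

Lemma fhom_morph P Q f : F P Q f -> {h : {morphism P >-> gT} | h = f :> (gT -> gT)}.
Proof. by move/fhomM=> fM; exists (Morphism fM). Qed.

Lemma fhom1 P Q f : F P Q f -> f 1 = 1.
Proof. by case/fhom_morph=> h <-; rewrite morph1. Qed.

Lemma fhomJ P Q f x y : F P Q f -> x \in P -> y \in P -> f (x ^ y) = f x ^ f y.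
Proof. by case/fhom_morph=> h <- Px Py; rewrite morphJ. Qed.

Lemma fhom_order P Q f x : F P Q f -> x \in P -> #[f x] = #[x].
Proof.
move=> Ff Px; have injf := fhom_injective Ff; case/fhom_morph: Ff injf => h <- injh.
by rewrite order_injm //; apply/injmP.
Qed.

Lemma fhom_group P Q f : F P Q f -> {R : {group gT} | R = f @: P :> {set gT}}.
Proof.
case/fhom_morph=> h <-; exists (h @* P)%G => /=.
by rewrite morphimEdom.
Qed.

Lemma fhom_inverse P Q R f : F P Q f -> R = f @: P :> {set gT} ->
  exists g, [/\ F R P g, {in P, cancel f g} & {in R, cancel g f}].
Proof.
case/fhom_factor=> R0 defR0 [Ff [g [Fg fK gK]]] defR.
have eqR : R0 = R by apply/val_inj; rewrite /= defR0 defR.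
by exists g; rewrite -eqR.
Qed.

Lemma fiso_fhom P Q R f : F P Q f -> R = f @: P :> {set gT} -> fiso F P R f.
Proof.
move=> Ff defR; have [g [Fg fK gK]] := fhom_inverse Ff defR; split; last by exists g.
by apply: (fhom_corestr Ff); rewrite defR // -defR (fhom_dom Fg).
Qed.

Lemma fiso_im P Q f : fiso F P Q f -> Q = f @: P :> {set gT}.
Proof.
case=> Ff [g [Fg _ gK]]; apply/eqP; rewrite eqEsubset (fhom_im Ff) andbT.
by apply/subsetP=> y Qy; rewrite -(gK y Qy) imset_f // (fhom_mem Fg).
Qed.

Lemma faut_group_set P : P \subset S -> group_set (faut F P).
Proof.
move=> sPS; apply/group_setP; split=> [|a b].
  rewrite inE group1 /=.
  have <- : F P P id = F P P (1 : {perm gT}).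
    by apply: fhom_eq_in => x _; rewrite perm1.
  exact: fhom_incl.
rewrite ![_ \in faut _ _]inE => /andP[Aa Fa] /andP[Ab Fb]; rewrite groupM //=.
have <- : F P P (b \o a) = F P P (a * b : {perm gT}).
  by apply: fhom_eq_in => x _; rewrite permM.
exact: fhom_comp Fa Fb.
Qed.

Lemma fhom_perm P f : F P P f -> exists2 a, a \in faut F P & {in P, a =1 f}.
Proof.
move=> Ff; have injf := fhom_injective Ff; have sfP := fhom_im Ff.
have eqa : {in P, perm_in injf sfP =1 f} by move=> x; apply: perm_inE.
exists (perm_in injf sfP) => //; rewrite inE; apply/andP; split.
  rewrite inE perm_in_on; apply/morphicP=> x y Px Py.
  by rewrite !eqa ?groupM // (fhomM Ff).
by rewrite (fhom_eq_in _ _ eqa).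
Qed.

Lemma faut_conj P :
  P \subset S -> faut (conj_fusion S) P = conj_aut P @* 'N_S(P).
Proof.
move=> sPS; apply/setP=> a; rewrite inE; apply/andP/morphimP.
  case=> Aa /conj_homsP[_ _ [s Ss [sPsP eqa]]].
  have nPs : s \in 'N(P) by rewrite inE.
  exists s; rewrite // ?inE ?Ss //.
  apply: (eq_Aut Aa); first by rewrite Aut_aut.
  by move=> x Px; rewrite norm_conj_autE //; apply: eqa.
case=> s nPs /setIP[Ss _] ->; split; first by rewrite Aut_aut.
apply/conj_homsP; split=> //; exists s => //; split; first by rewrite (normP nPs).
by move=> x Px; rewrite /= norm_conj_autE.
Qed.

Lemma fully_normalized_conj P :
  P \subset S -> exists2 Q, fully_normalized F Q & exists f, fiso F P Q f.
Proof.
(* Finite functions make [F]-conjugacy decidable, which allows a conjugate to be picked by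
   maximality; only values on [P] matter. *)
move=> sPS; pose conjP Q := [exists f : {ffun gT -> gT}, F P Q f && (f @: P == Q)].
have conjPP Q : reflect (exists f, fiso F P Q f) (conjP Q).
  apply: (iffP existsP) => [[f /andP[Ff /eqP defQ]] | [f isof]].
    by exists f; apply: (fiso_fhom Ff).
  have eqf : {in P, [ffun x => f x] =1 f} by move=> x _; rewrite ffunE.
  exists [ffun x => f x]; rewrite (fhom_eq_in _ _ eqf) (eq_in_imset eqf).
  by rewrite -(fiso_im isof) eqxx andbT; case: isof.
have conjPid : conjP P.
  apply/conjPP; exists id; split; first exact: fhom_incl.
  by exists id; split=> //; apply: fhom_incl.
case: (@arg_maxnP _ P conjP (fun Q => #|'N_S(Q)|) conjPid) => Q /conjPP[f isof] maxQ.
exists Q; last by exists f.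
split=> [|R [g isog]]; first by case: isof => /fhom_cod.
apply: maxQ; apply/conjPP; exists (g \o f).
have [[Ff _] [Fg _]] := (isof, isog).
by apply: (fiso_fhom (fhom_comp Ff Fg)); rewrite imset_comp -(fiso_im isof) (fiso_im isog).
Qed.

End FusionBasics.

(** * Alperin's argument *)

(** Every Sylow [q]-subgroup of [G] with [q != p] consists of [q]-elements, hence lies in [H]; so
    each primary part of [#|G|] divides [#|H :&: G|]. *)
Lemma Sylow_primeelt_gen (gT : finGroupType) p (G A H : {group gT}) :
    p.-Sylow(G) A -> A \subset H ->
    (forall q x, prime q -> q != p -> x \in G -> q.-elt x -> x \in H) ->
  G \subset H.
Proof.
move=> sylA sAH H_elt; have : #|G| %| #|H :&: G|.
  apply/dvdn_partP => // q; rewrite mem_primes => /and3P[q_pr _ _].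
  have [-> | neq_qp] := eqVneq q p.
    rewrite -(card_Hall sylA) cardSg // subsetI sAH.
    by case/andP: sylA.
  have [Q sylQ] := Sylow_exists q G; have [sQG qQ _] := and3P sylQ.
  rewrite -(card_Hall sylQ) cardSg // subsetI sQG andbT.
  apply/subsetP=> x Qx; apply: H_elt (q_pr) neq_qp (subsetP sQG x Qx) _.
  exact: mem_p_elt qQ Qx.
move/(dvdn_leq (cardG_gt0 _)) => leGH; apply/setIidPr/eqP.
by rewrite eqEcard subsetIr leGH.
Qed.

Section Saturated.

Variables (gT : finGroupType) (S : {group gT}) (F : fusion_system S) (p : nat).
Hypotheses (pS : p.-group S) (satF : saturated F p).
Implicit Types (P Q R N : {group gT}) (f g : gT -> gT).

Lemma fully_normalized_full : fully_normalized F S.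
Proof.
split=> // Q [g isog]; have defQ := fiso_im isog.
suffices -> : Q = S by [].
apply/eqP; rewrite -val_eqE eqEcard /= (fhom_cod isog.1) defQ.
by rewrite (card_in_imset (fhom_injective isog.1)) leqnn.
Qed.

Lemma fully_normalizedS P : fully_normalized F P -> P \subset S.
Proof. by case. Qed.

(** The group [B], which is Aut_S(R) carried over by [f], is a [p]-subgroup of Aut_F(P). Since
    Aut_S(P) is Sylow there, some [a] in Aut_F(P) conjugates [B] into it, and [g] is [a \o f]. The
    conclusion says that [ext_dom] of [g] contains ['N_S(R)]. *)
Lemma fiso_Aut_Sylow R P f : fully_normalized F P -> fiso F R P f ->
  exists g, fiso F R P g /\
    {in 'N_S(R), forall t, exists2 s, s \in 'N_S(P)
                                    & {in R, forall y, g (y ^ t) = g y ^ s}}.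
Proof.
move=> nP isof; have [Ff [f' [Ff' fK f'K]]] := isof.
have sPS := fully_normalizedS nP; have sRS := fhom_dom Ff.
have [_ sylA] := satF.1 P nP.
have [h defh] := fhom_morph Ff; have injh : 'injm h.
  by apply/injmP; rewrite defh; exact: (fhom_injective Ff).
have defP : h @* R = P by rewrite morphimEdom defh -(fiso_im isof).
pose B := Aut_isom injh (subxx R) @* (conj_aut R @* 'N_S(R)).
have pB : p.-group B by rewrite !morphim_pgroup // (pgroupS (subsetIl _ _)).
pose G := Group (faut_group_set F sPS).
have sBG : B \subset G.
  apply/subsetP=> _ /morphimP[c _ /morphimP[t nRt /setIP[St _] def_c] ->].
  rewrite {c}def_c.
  rewrite inE -{1}defP Aut_Aut_isom /=.
  have eqf : {in P, f \o (conjg^~ t) \o f' =1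
                    Aut_isom injh (subxx R) (conj_aut R t)}.
    move=> y Py /=; have Rfy : f' y \in R := fhom_mem Ff' Py.
    rewrite -{2}(f'K y Py) -defh Aut_isomE ?Aut_aut //.
    by rewrite norm_conj_autE.
  rewrite -(fhom_eq_in F P eqf); apply: (fhom_comp Ff').
  apply: fhom_comp Ff; apply/fhom_conj/conj_homsP; split=> //.
  by exists t => //; split=> //; rewrite (normP nRt).
have sylA' : p.-Sylow(G) (conj_aut P @* 'N_S(P)) by rewrite -faut_conj.
have [a Ga sBaA] := Sylow_Jsub sylA' sBG pB.
exists (a \o f); have /setIdP[Aa Fa] : a \in faut F P := Ga.
have Faf := fhom_comp Ff Fa; split.
  apply: (fiso_fhom Faf); rewrite imset_comp -(fiso_im isof).
  by rewrite -[LHS](im_autm Aa) morphimEdom.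
move=> t Nt; have [St nRt] := setIP Nt.
pose b := Aut_isom injh (subxx R) (conj_aut R t).
have Bb : b \in B by rewrite !mem_morphim // Aut_aut.
have : b ^ a \in B :^ a by rewrite memJ_conjg.
move/(subsetP sBaA)/morphimP=> [s nPs Ns def_s].
exists s => // y Ry /=; have Pfy : f y \in P by apply: fhom_mem Ff Ry.
have Pafy : a (f y) \in P by apply: Aut_closed.
rewrite -(norm_conj_autE nPs Pafy) -def_s permJ -defh.
by rewrite Aut_isomE ?Aut_aut // norm_conj_autE.
Qed.

(** This says that [N] contains the hyperfocal subgroup of [F]: the automorphisms quantified over
    generate the groups O^p(Aut_F(P)). *)
Definition focal_residual N := forall P q (a : {perm gT}),
  prime q -> q != p -> a \in faut F P -> q.-elt a ->
  {in P, forall x, x^-1 * a x \in N}.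

Section Alperin.

Variable N : {group gT}.
Hypotheses (nNS : S \subset 'N(N)) (resN : focal_residual N).

Definition conj_mod P f :=
  exists2 s, s \in S & {in P, forall x, coset N (f x) = coset N x ^ coset N s}.

(** The automorphisms that are [S]-conjugations modulo [N] form a subgroup [H] of Aut_F(P). It
    contains the Sylow subgroup Aut_S(P) and, by [resN], all [q]-elements with [q != p], so it is
    everything. *)
Lemma conj_mod_faut P (a : {perm gT}) :
  fully_normalized F P -> a \in faut F P -> conj_mod P a.
Proof.
move=> nP Fa; have sPS := fully_normalizedS nP; have [_ sylA] := satF.1 P nP.
have nNx x : x \in S -> x \in 'N(N) by apply: (subsetP nNS).
have Sx x : x \in P -> x \in S by apply: (subsetP sPS).
pose G := Group (faut_group_set F sPS).
pose H := [set a in G | [exists s in S, [forall x in P,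
            coset N (a x) == coset N x ^ coset N s]]].
have HP b : reflect (b \in G /\ conj_mod P b) (b \in H).
  apply: (iffP setIdP) => -[Gb good_b]; split=> //.
    by case/exists_inP: good_b => s Ss /eqfun_inP eqb; exists s.
  by case: good_b => s Ss eqb; apply/exists_inP; exists s => //; apply/eqfun_inP.
have gH : group_set H.
  apply/group_setP; split.
    apply/HP; split; first exact: group1.
    by exists 1 => // x _; rewrite perm1 morph1 conjg1.
  move=> b c /HP[Gb [s Ss eqb]] /HP[Gc [t St eqc]]; apply/HP; split.
    exact: groupM.
  exists (s * t); rewrite ?groupM // => x Px.
  have /setIdP[Ab _] : b \in faut F P := Gb.
  by rewrite permM eqc ?Aut_closed // eqb // morphM ?conjgM ?nNx.
suffices /subsetP sGH : G \subset Group gH by case/HP: (sGH a Fa).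
apply: (Sylow_primeelt_gen (p := p) (A := (conj_aut P @* 'N_S(P))%G)).
- by rewrite faut_conj in sylA.
- apply/subsetP=> b Ab; have /setIdP[AutAb] : b \in faut (conj_fusion S) P.
    by rewrite faut_conj.
  case/conj_homsP=> _ _ [s Ss [_ eqb]]; apply/HP; split.
    case/and3P: sylA => /subsetP sAG _ _; apply: sAG.
    by rewrite faut_conj.
  by exists s => // x Px; rewrite eqb //= morphJ ?nNx // Sx.
move=> q b q_pr qp Gb qb; apply/HP; split=> //; exists 1 => // x Px.
have /setIdP[Ab _] : b \in faut F P := Gb.
have Nx := nNx x (Sx x Px).
have Nbx : b x \in 'N(N) by rewrite nNx // Sx // Aut_closed.
rewrite morph1 conjg1 -[b x](mulKVg x) morphM ?groupM ?groupV //.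
by rewrite [X in _ * X](coset_id (resN q_pr qp Gb qb Px)) mulg1.
Qed.

(** Downward induction on [#|P|]. Both [P] and its image [R] are mapped onto a fully normalized [P0]
    by isomorphisms [g] and [k] that extend to the normalizers in [S]. These are strictly larger, so
    induction settles [g] and [k]; the automorphism [k f g^-1] of [P0] is settled by
    [conj_mod_faut]. *)
Lemma focal_residual_conj_mod P f : F P S f -> conj_mod P f.
Proof.
have nNx x : x \in S -> x \in 'N(N) by apply: (subsetP nNS).
have [n] := ubnP (#|S| - #|P|); elim: n P f => // n IHn P f leSP Ff.
have sPS := fhom_dom Ff; have Sx x : x \in P -> x \in S by apply: (subsetP sPS).
have [eqPS | neqPS] := eqVneq P S.
  rewrite eqPS in Ff *; have [a Fa eqa] := fhom_perm Ff.
  have [s Ss eqs] := conj_mod_faut fully_normalized_full Fa.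
  by exists s => // x Sx'; rewrite -eqa // eqs.
have [P0 nP0 [g0 isog0]] := fully_normalized_conj F sPS.
have [R defR] := fhom_group Ff.
have [f' [Ff' fK f'K]] := fhom_inverse Ff defR.
have sRS := fhom_dom Ff'.
have eqcard : #|R| = #|P| by rewrite defR (card_in_imset (fhom_injective Ff)).
have cP0 := (satF.1 P0 nP0).1.
have good Q g : #|Q| = #|P| -> fiso F Q P0 g ->
    {in 'N_S(Q), forall t, exists2 s, s \in 'N_S(P0)
                                    & {in Q, forall y, g (y ^ t) = g y ^ s}} ->
  conj_mod Q g.
  move=> eqQ isog g_norm; have [Fg _] := isog; have sQS := fhom_dom Fg.
  have defP0 := fiso_im isog.
  have [M defM [k Fk eqk]] := satF.2 Q P0 g (fhomS Fg) defP0 cP0.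
  have sNM : 'N_S(Q) \subset M.
    rewrite defM; apply/subsetP=> t Nt; rewrite inE Nt; have [s Ns eqs] := g_norm t Nt.
    apply/exists_inP; exists s; first by rewrite -defP0.
    by apply/forall_inP=> y Qy; rewrite eqs.
  have ltQM : #|Q| < #|M|.
    apply: leq_trans (subset_leq_card sNM); apply: proper_card.
    apply: nilpotent_proper_norm (pgroup_nil pS) _.
    rewrite properEneq sQS andbT; apply: contra neqPS => /eqP eqQS.
    by rewrite -val_eqE eqEcard sPS -eqQ /= eqQS.
  have [|s Ss eqs] := IHn M k _ Fk.
    have leMS := subset_leq_card (fhom_dom Fk).
    rewrite -ltnS (leq_trans _ leSP) // ltnS ltn_sub2l // -eqQ //.
    exact: leq_trans ltQM leMS.
  exists s => // x Qx; rewrite -eqk // eqs // (subsetP sNM) // inE (subsetP sQS) //.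
  exact: (subsetP (normG Q)).
have [g [isog g_norm]] := fiso_Aut_Sylow nP0 isog0.
have [Fg [g' [Fg' gK g'K]]] := isog.
have FfR : F P R f by apply: (fhom_corestr Ff); rewrite ?defR // -defR.
have isof' : fiso F R P f' by split=> //; exists f; split.
have isogf : fiso F R P0 (g \o f').
  apply: (fiso_fhom (fhom_comp Ff' Fg)); rewrite imset_comp.
  by rewrite -(fiso_im isof') (fiso_im isog).
have [k [isok k_norm]] := fiso_Aut_Sylow nP0 isogf.
have [s1 Ss1 eqg] := good P g erefl isog g_norm.
have [s2 Ss2 eqk] := good R k eqcard isok k_norm.
have [a Fa eqa] := fhom_perm (fhom_comp Fg' (fhom_comp FfR isok.1)).
have [s3 Ss3 eqs3] := conj_mod_faut nP0 Fa.
(* [f] is [k^-1 a g], where [s1], [s3], [s2] belong to [g], [a], [k]. *)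
exists (s1 * s3 * s2^-1); rewrite ?groupM ?groupV // => x Px.
have Rfx : f x \in R by rewrite defR imset_f.
rewrite !morphM ?morphV ?nNx ?groupM ?groupV // !conjgM -eqg //.
rewrite -eqs3 ?(fhom_mem Fg) // eqa ?(fhom_mem Fg) //= gK //.
by rewrite eqk // conjgK.
Qed.

End Alperin.

End Saturated.

(** * Marks of virtual sets *)

Section Marks.

Variables (gT : finGroupType) (D : {group gT}).
Implicit Types (A : {set gT}) (B G H M : {group gT}) (X Y : seq (int * {group gT})).

(** An entry of Burnside's table of marks of [D], with [A] any set so that it can be [w |: G] or a
    single pair. *)
Definition mark A B := #|'Fix_(rcosets B D | 'Rs)(A)|.

Lemma mark_gen A B : mark <<A>> B = mark A B.
Proof. by rewrite /mark afix_gen. Qed.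

Lemma mark_fixP A B (C : {set gT}) :
  reflect (exists2 d, d \in D & C = B :* d /\ A \subset B :^ d)
          (C \in 'Fix_(rcosets B D | 'Rs)(A)).
Proof.
apply: (iffP setIP) => [[/rcosetsP[d Dd ->]] | [d Dd [-> sAB]]].
  by rewrite sub_afixRs_norms => sAB; exists d.
by rewrite sub_afixRs_norms -rcosetE imset_f.
Qed.

Lemma markJ A B d : d \in D -> mark (A :^ d) B = mark A B.
Proof.
move=> Dd; rewrite /mark -[RHS](card_imset _ (act_inj 'Rs d)).
apply: eq_card => C; apply/mark_fixP/imsetP => [[e De [-> sAB]] | [C' /mark_fixP]].
  exists (B :* (e * d^-1)); last by rewrite /= rcosetE -rcosetM mulgKV.
  apply/mark_fixP; exists (e * d^-1); rewrite ?groupM ?groupV //; split=> //.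
  by rewrite conjsgM -sub_conjg.
case=> e De [-> sAB] ->; exists (e * d); rewrite ?groupM //= rcosetE rcosetM.
by split; rewrite // conjsgM conjSg.
Qed.

Lemma mark_neq0 A B : mark A B != 0 -> exists2 d, d \in D & A \subset B :^ d.
Proof.
rewrite -lt0n => /card_gt0P[C /mark_fixP[d Dd [_ sAB]]]; by exists d.
Qed.

Lemma mark_self B : mark B B = #|'N_D(B) : B|.
Proof. by rewrite /mark afixRs_rcosets. Qed.

Lemma mark_dvd G B : #|G| = #|B| -> #|'N_D(G) : G| %| mark G B.
Proof.
move=> eqGB; have [-> | /mark_neq0[d Dd sGB]] := eqVneq (mark G B) 0.
  exact: dvdn0.
have defG : G :=: B :^ d by apply/eqP; rewrite eqEcard sGB cardJg eqGB leqnn.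
rewrite defG markJ // mark_self -{1}(conjGid Dd) normJ -conjIg.
by rewrite -!divgI -!conjIg !cardJg.
Qed.

(** [M] normalizes [G], so it acts on the cosets fixed by [G]; those also fixed by [w] number
    [mark (w |: G) B], and the Cauchy-Frobenius formula gives [#|M|] times the number of orbits. *)
Lemma mark_sum G B M : M \subset 'N_D(G) ->
  #|M| %| \sum_(w in M) mark (w |: G) B.
Proof.
rewrite subsetI => /andP[sMD nGM]; pose Y := 'Fix_(rcosets B D | 'Rs)(G).
have actY : [acts M, on Y | 'Rs].
  apply/actsP=> m Mm C; rewrite /Y.
  have Dm := subsetP sMD m Mm; have nGm := subsetP nGM m Mm.
  apply/mark_fixP/mark_fixP => -[d Dd [eqC sGB]].
    exists (d * m^-1); rewrite ?groupM ?groupV //; split.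
      rewrite rcosetM -eqC /= rcosetE -rcosetM mulgV rcoset1 //.
    by rewrite conjsgM -sub_conjg (normP nGm).
  exists (d * m); rewrite ?groupM //= eqC rcosetE rcosetM; split=> //.
  by rewrite conjsgM -(normP nGm) conjSg.
have := Frobenius_Cauchy actY => defsum.
rewrite (eq_bigr (fun w => #|'Fix_(Y | 'Rs)[w]|)) ?defsum ?dvdn_mull // => w _.
by rewrite /mark afixU /Y -setIA [_ :&: 'Fix__(G)]setIC.
Qed.

(** The list [X] encodes a virtual [D]-set, a formal integer combination of coset spaces of [D];
    [msum X A] is its number of [A]-fixed points. *)
Definition msum X A : int :=
  (\sum_(x <- X) x.1 * (mark A x.2)%:Z)%R.

Lemma msum_cat X Y A : msum (X ++ Y) A = (msum X A + msum Y A)%R.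
Proof. exact: big_cat. Qed.

Lemma msum_gen X A : msum X <<A>> = msum X A.
Proof. by apply: eq_bigr => x _; rewrite mark_gen. Qed.

Lemma msumJ X A d : d \in D -> msum X (A :^ d) = msum X A.
Proof. by move=> Dd; apply: eq_bigr => x _; rewrite markJ. Qed.

Lemma msum_eq0 X A :
    (forall c B d, (c, B) \in X -> d \in D -> ~~ (A \subset B :^ d)) ->
  msum X A = 0%R.
Proof.
move=> notAX; rewrite /msum big_seq big1 // => -[c B] XB /=.
have [-> | /mark_neq0[d Dd sAB]] := eqVneq (mark A B) 0; first exact: mulr0.
by have := notAX c B d XB Dd; rewrite sAB.
Qed.

Lemma msum_dvd X G : (forall c B, (c, B) \in X -> #|B| = #|G|) ->
  (#|'N_D(G) : G| %| msum X G)%Z.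
Proof.
move=> cardX; rewrite /msum big_seq rpred_sum // => -[c B] XB.
by rewrite dvdz_mull // dvdzE /= mark_dvd // (cardX c).
Qed.

(* The fixed point counts of w |: G, w in M, add up to #|M| times the number of
   M-orbits on the fixed points of G, and w |: G = G for w in G. *)
Lemma msum_congr X G M (psi : {morphism M >-> gT}) :
    M \subset 'N_D(G) -> G \subset M -> 'injm psi -> psi @* M \subset D ->
    {in M :\: G, forall w, msum X (psi @* (w |: G)) = msum X (w |: G)} ->
  (#|M : G| %| (msum X G - msum X (psi @* G))%R)%Z.
Proof.
move=> sMN sGM injpsi sMD eqX.
have sum_dvd H (K : {group gT}) :
    K \subset 'N_D(H) -> (#|K| %| (\sum_(w in K) msum X (w |: H))%R)%Z.
  move=> sKN; rewrite /msum exchange_big /= rpred_sum // => x _.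
  rewrite -mulr_sumr dvdz_mull // -(big_morph Posz PoszD (erefl _)).
  by rewrite dvdzE mark_sum.
have nGM : M \subset 'N(G) by case/subsetIP: sMN.
have dvdM := sum_dvd G M sMN.
have /(sum_dvd _ (psi @* M)%G) : psi @* M \subset 'N_D(psi @* G).
  by rewrite subsetI sMD morphim_norms.
rewrite /= card_injm // (morphimEdom psi) big_imset /=; last exact/injmP.
move=> dvdM'; have {dvdM dvdM'} := rpredB dvdM dvdM'; rewrite -sumrB.
rewrite (big_setID G) /= [X in (_ + X)%R]big1 ?addr0 => [|w MGw]; last first.
  rewrite -eqX // morphimU morphim_set1 ?subrr //.
  by case/setDP: MGw.
rewrite (eq_bigr (fun => (msum X G - msum X (psi @* G))%R)) => [|w]; last first.
  case/setIP=> Mw Gw; congr (msum X _ - msum X _)%R.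
    by apply/setUidPr; rewrite sub1set.
  by apply/setUidPr; rewrite sub1set mem_morphim.
rewrite (setIidPr sGM) sumr_const -mulr_natl -(Lagrange sGM).
by rewrite PoszM natz dvdz_mul2l // -lt0n cardG_gt0.
Qed.

(** Among subgroups of the same order [k], the coset space of [G] has nonzero marks only at
    conjugates of [G], so the values [T] can be reached one subgroup after another. *)
Lemma msum_adjust X (T : {group gT} -> int) (L : seq {group gT}) k :
    {in L, forall G, [/\ G \subset D, #|G| = k &
       (#|'N_D(G) : G| %| (T G - msum X G)%R)%Z]} ->
    {in L &, forall G H d, d \in D -> H :=: G :^ d -> T H = T G} ->
  exists2 Y, (forall c B, (c, B) \in Y -> B \in L)
           & {in L, forall G, msum (Y ++ X) G = T G}.
Proof.
elim: L => [|G L IHL] LP TP; first by exists [::].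
have [||Y YL YT] := IHL.
- by move=> H LH; apply: LP; rewrite inE LH orbT.
- by move=> H K LH LK; apply: TP; rewrite inE ?LH ?LK orbT.
have [sGD cardG dvdG] := LP G (mem_head _ _).
pose n := #|'N_D(G) : G|.
(* The division is exact: [Y] consists of groups of order [k], so its mark at [G] is divisible by
   [n] too. *)
pose c := ((T G - msum (Y ++ X) G)%R %/ n)%Z.
have c_n : (c * n = T G - msum (Y ++ X) G)%R.
  apply: divzK; rewrite msum_cat opprD addrCA rpredDl //.
  rewrite rpredN msum_dvd // => b B YB.
  by have [|_ -> _] := LP B; rewrite ?inE ?(YL b) ?orbT.
exists ((c, G) :: Y) => [b B|].
  by rewrite !inE => /predU1P[[_ ->] | /YL->]; rewrite ?eqxx ?orbT.
have eqm H : msum (((c, G) :: Y) ++ X) H = (c * (mark H G)%:Z + msum (Y ++ X) H)%R.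
  by rewrite /msum big_cons.
move=> H; rewrite eqm inE => /predU1P[-> | LH]; first by rewrite mark_self c_n subrK.
have [-> | /mark_neq0[d Dd sHG]] := eqVneq (mark H G) 0.
  by rewrite mulr0 add0r YT.
have [_ cardH _] := LP H (mem_behead (s := G :: L) LH).
have defH : H :=: G :^ d by apply/eqP; rewrite eqEcard sHG cardJg cardG cardH leqnn.
have eqT : T H = T G by apply: TP defH; rewrite ?inE ?eqxx ?LH ?orbT.
(* A conjugate of [G] has been dealt with already, so [Y ++ X] has the right mark at [G] and no
   correction is made. *)
suffices -> : c = 0%R by rewrite mul0r add0r YT.
have -> : c = ((T G - msum (Y ++ X) G)%R %/ n)%Z by [].
by rewrite -(msumJ _ _ Dd) -defH YT // eqT subrr div0z.
Qed.

End Marks.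

(** * Graphs of morphisms *)

Section Graphs.

Variables (gT : finGroupType) (S : {group gT}) (F : fusion_system S) (p : nat).
Hypotheses (pS : p.-group S) (satF : saturated F p).
Implicit Types (P Q R : {group gT}) (f g : gT -> gT) (A : {set gT * gT}).
Implicit Types (G H : {group gT * gT}).

Let D := setX_group S S.

(* The pair (x, y) acts on an (S, S)-biset by x on the left, y on the right, so
   F acts on graphs through the first component. *)
Definition graph g R : {set gT * gT} := [set (g y, y) | y in R].

Definition twist f A : {set gT * gT} := [set (f z.1, z.2) | z in A].

Lemma mem_graph g R x y : ((x, y) \in graph g R) = (y \in R) && (x == g y).
Proof.
apply/imsetP/andP => [[z Rz [-> ->]] | [Ry /eqP->]]; first by rewrite Rz.
by exists y.
Qed.

Lemma card_graph g R : #|graph g R| = #|R|.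
Proof. by rewrite card_imset // => x y []. Qed.

Lemma eq_graph g f R : {in R, g =1 f} -> graph g R = graph f R.
Proof. by move=> eqgf; apply: eq_in_imset => y Ry; rewrite eqgf. Qed.

Lemma twist_graph f g R : twist f (graph g R) = graph (f \o g) R.
Proof. by rewrite /twist -imset_comp. Qed.

Lemma graph_group_set R Q g : F R Q g -> group_set (graph g R).
Proof.
move=> Fg; apply/group_setP; split=> [|[x y] [x' y']].
  by rewrite mem_graph group1 (fhom1 Fg) eqxx.
rewrite !mem_graph => /andP[Ry /eqP->] /andP[Ry' /eqP->].
by rewrite groupM //= (fhomM Fg) ?eqxx.
Qed.

Lemma graph_sub R Q g : F R Q g -> graph g R \subset setX Q R.
Proof.
move=> Fg; apply/subsetP=> -[x y]; rewrite mem_graph inE /= => /andP[Ry /eqP->].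
by rewrite Ry (fhom_mem Fg).
Qed.

Lemma graph_subD R Q g : F R Q g -> graph g R \subset D.
Proof.
move=> Fg; apply: subset_trans (graph_sub Fg) _.
by rewrite setXS ?(fhom_cod Fg) ?(fhom_dom Fg).
Qed.

Definition fusion_graph A :=
  [exists R : {group gT}, [exists g : {ffun gT -> gT}, F R S g && (A == graph g R)]].

Lemma fusion_graphP A :
  reflect (exists R, exists2 g, F R S g & A = graph g R) (fusion_graph A).
Proof.
apply: (iffP existsP) => [[R /existsP[g /andP[Fg /eqP->]]] | [R [g Fg ->]]].
  by exists R, g.
have eqg : {in R, [ffun x => g x] =1 g} by move=> x _; rewrite ffunE.
exists R; apply/existsP; exists [ffun x => g x].
by rewrite (fhom_eq_in F S eqg) Fg (eq_graph eqg) eqxx.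
Qed.

Lemma fusion_graph_sub G H : G \subset H -> fusion_graph H -> fusion_graph G.
Proof.
move=> sGH /fusion_graphP[R [g Fg defH]].
have sGgr x y : (x, y) \in G -> y \in R /\ x = g y.
  by move/(subsetP sGH); rewrite defH mem_graph => /andP[Ry /eqP].
have sR : [group of snd @* G] \subset R.
  by apply/subsetP=> _ /morphimP[[x y] _ /sGgr[Ry _] ->].
apply/fusion_graphP; exists [group of snd @* G], g; first exact: fhom_restr Fg.
apply/setP=> -[x y]; rewrite mem_graph; apply/idP/andP=> [Gxy | [Gy /eqP->]].
  have [_ ->] := sGgr _ _ Gxy; split=> //.
  by apply/morphimP; exists (x, y); rewrite ?inE.
by case/morphimP: Gy => -[x' y'] _ Gxy /= ->; have [_ <-] := sGgr _ _ Gxy.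
Qed.

Lemma fusion_graphJ A z : z \in D -> fusion_graph A -> fusion_graph (A :^ z).
Proof.
case: z => s t /setXP[/= Ss St] /fusion_graphP[R [g Fg ->]].
have FR : F (R :^ t)%G R (conjg^~ t^-1).
  have sRS := fhom_dom Fg; have sRtS : R :^ t \subset S by rewrite -(conjGid St) conjSg.
  apply/fhom_conj/conj_homsP; split=> //; exists t^-1; rewrite ?groupV //=.
  by rewrite conjsgK.
have Fs : F S S (conjg^~ s).
  by apply/fhom_conj/conj_homsP; split=> //; exists s; rewrite ?conjGid.
apply/fusion_graphP; exists (R :^ t)%G, ((conjg^~ s \o g) \o conjg^~ t^-1).
  exact: fhom_comp FR (fhom_comp Fg Fs).
apply/setP=> -[x y]; rewrite mem_conjg.
have -> : (x, y) ^ (s, t)^-1 = (x ^ s^-1, y ^ t^-1) by [].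
by rewrite !mem_graph mem_conjg -(inj_eq (conjg_inj s)) conjgKV.
Qed.

Lemma fusion_graph_twist P f A :
  F P S f -> A \subset setX P S -> fusion_graph A -> fusion_graph (twist f A).
Proof.
move=> Ff sAP /fusion_graphP[R [g Fg defA]]; rewrite defA twist_graph.
apply/fusion_graphP; exists R, (f \o g) => //; apply: fhom_comp (Ff).
apply: (fhom_corestr Fg) (fhom_dom Ff); apply/subsetP=> _ /imsetP[y Ry ->].
have : (g y, y) \in A by rewrite defA mem_graph Ry eqxx.
by case/(subsetP sAP)/setXP.
Qed.

Lemma fusion_graph_twist_inv P f A :
  F P S f -> A \subset setX P S -> fusion_graph (twist f A) -> fusion_graph A.
Proof.
move=> Ff sAP; have [Q defQ] := fhom_group Ff.
have [f' [Ff' fK f'K]] := fhom_inverse Ff defQ.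
have sAQ : twist f A \subset setX Q S.
  apply/subsetP=> _ /imsetP[[x y] /(subsetP sAP)/setXP[/= Px Sy] ->].
  by apply/setXP; rewrite defQ imset_f.
move/(fusion_graph_twist (fhomS Ff') sAQ); rewrite /twist -imset_comp.
rewrite (eq_in_imset (g := id)) ?imset_id // => -[x y].
by case/(subsetP sAP)/setXP=> /= Px Sy; rewrite fK.
Qed.

Lemma twistM P f : F P S f ->
  {in setX P S &, {morph (fun z => (f z.1, z.2)) : z w / z * w}}.
Proof.
move=> Ff [x y] [x' y'] /setXP[/= Px _] /setXP[/= Px' _].
by rewrite (fhomM Ff).
Qed.

Lemma twist_inj P f : F P S f ->
  {in setX P S &, injective (fun z => (f z.1, z.2))}.
Proof.
move=> Ff [x y] [x' y'] /setXP[/= Px _] /setXP[/= Px' _] [eqf ->].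
by rewrite (fhom_injective Ff Px Px' eqf).
Qed.

Lemma twist_gen P f A : F P S f -> A \subset setX P S -> <<twist f A>> = twist f <<A>>.
Proof.
move=> Ff sAP; pose h := Morphism (twistM Ff).
have sgAP : <<A>> \subset setX P S by rewrite gen_subG.
by have := morphim_gen h sAP; rewrite !morphimEsub.
Qed.

Lemma card_twist P f A : F P S f -> A \subset setX P S -> #|twist f A| = #|A|.
Proof.
move=> Ff sAP; apply: card_in_imset; apply: sub_in2 (twist_inj Ff).
exact/subsetP.
Qed.

Lemma twist_subD P f A : F P S f -> A \subset setX P S -> twist f A \subset D.
Proof.
move=> Ff sAP; apply/subsetP=> _ /imsetP[[x y] /(subsetP sAP)/setXP[/= Px Sy] ->].
by apply/setXP; rewrite (fhom_mem Ff).
Qed.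

(** At [k = 0] this is full [F]-stability on the left; it is reached by lowering [k] one at a
    time. *)
Definition stable_above k X := forall P f A, F P S f -> A \subset setX P S ->
  k < #|<<A>>| -> msum D X (twist f A) = msum D X A.

(* If (s, t) normalizes the graph of g, then s lies in the extension domain of
   h g^-1, because h carries Aut_S(R) into Aut_S(P). *)
Lemma graph_congr X k R P g h : stable_above k X -> #|R| = k -> F R S g ->
    fully_normalized F P -> fiso F R P h ->
    {in 'N_S(R), forall t, exists2 s, s \in 'N_S(P)
                                    & {in R, forall y, h (y ^ t) = h y ^ s}} ->
  (#|'N_D(graph g R) : graph g R| %|
      (msum D X (graph g R) - msum D X (graph h R))%R)%Z.
Proof.
move=> stX cardR Fg nP isoh h_norm; have [Fh _] := isoh.
have [Q defQ] := fhom_group Fg.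
have [g' [Fg' gK g'K]] := fhom_inverse Fg defQ.
have Fphi := fhom_comp Fg' Fh; set phi := h \o g' in Fphi.
have defP : P = phi @: Q :> {set gT}.
  rewrite imset_comp -(fiso_im (P := Q) (Q := R) (F := F)) ?(fiso_im isoh) //.
  split=> //; exists g; split=> //.
  by apply: (fhom_corestr Fg); rewrite -?defQ // (fhom_dom Fg').
have [N defN [k' Fk eqk]] := satF.2 Q P phi (fhomS Fphi) defP (satF.1 P nP).1.
pose G := Group (graph_group_set Fg); rewrite -[graph g R]/(G : {set _}).
pose M := 'N_D(G)%G.
have sGM : G \subset M by rewrite subsetI normG (graph_subD Fg).
have sMN : M \subset setX N S.
  apply/subsetP=> -[s t] /setIP[/setXP[/= Ss St] nGst].
  have eqg y : y \in R -> y ^ t \in R /\ g (y ^ t) = g y ^ s.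
    move=> Ry; have : (g y, y) ^ (s, t) \in G.
      by rewrite memJ_norm // mem_graph Ry eqxx.
    by rewrite [_ ^ _](_ : _ = (g y ^ s, y ^ t)) // mem_graph => /andP[? /eqP].
  have nRt : t \in 'N(R).
    by rewrite inE; apply/subsetP=> _ /imsetP[y /eqg[Ry _] ->].
  have nQs : s \in 'N(Q).
    rewrite inE; apply/subsetP=> _ /imsetP[x Qx ->].
    move: Qx; rewrite defQ => /imsetP[y /eqg[Ryt eqy] ->].
    by rewrite -eqy imset_f.
  have [|s' Ns' eqs'] := h_norm t; first exact/setIP.
  apply/setXP; split=> //=; rewrite defN; apply/setIdP; split; first exact/setIP.
  apply/exists_inP; exists s'; first by rewrite -defP.
  apply/forall_inP=> x; rewrite defQ => /imsetP[y Ry ->].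
  have [Ryt <-] := eqg y Ry.
  by rewrite /phi /= !gK // eqs'.
have psiM := sub_in2 (subsetP sMN) (twistM Fk); pose psi := Morphism psiM.
have psiE A : A \subset M -> psi @* A = twist k' A by move=> sAM; rewrite morphimEsub.
have eqG : psi @* G = graph h R.
  rewrite psiE // twist_graph; apply: eq_graph => y Ry /=.
  by rewrite eqk ?defQ ?imset_f //= /phi /= gK.
rewrite -eqG; apply: msum_congr => //.
- by have injM := sub_in2 (subsetP sMN) (twist_inj Fk); apply/injmP.
- by rewrite psiE // (twist_subD Fk).
(* An element outside [G] makes the generated subgroup larger than [k], where stability is
   assumed. *)
move=> w /setDP[Mw notGw].
have sAM : w |: G \subset M by rewrite subUset sub1set Mw.
rewrite psiE // (stX _ _ _ Fk) ?(subset_trans sAM) //.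
rewrite -cardR -(card_graph g) proper_card //.
apply/properP; split; first by rewrite sub_gen // subsetUr.
by exists w => //; rewrite mem_gen // setU11.
Qed.

End Graphs.

(** The choice is made from the orbit alone; it will make prescribed marks constant on conjugacy
    classes. *)
Lemma group_class_repr (gT : finGroupType) (S : {group gT}) :
  exists rep : {group gT} -> {group gT},
    (forall R, exists2 s, s \in S & rep R = (R :^ s)%G)
    /\ (forall R s, s \in S -> rep (R :^ s)%G = rep R).
Proof.
exists (fun R => odflt R [pick Q in orbit 'JG%act S R]); split=> R.
  case: pickP => [Q /orbitP[s Ss <-] | /(_ R)]; first by exists s.
  by rewrite orbit_refl.
move=> s Ss; have -> : orbit 'JG%act S (R :^ s)%G = orbit 'JG%act S R.
  exact: (orbit_act 'JG%act).
by case: pickP => // /(_ R); rewrite orbit_refl.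
Qed.

(** * Correcting the fixed-point counts at one order *)

Section StableSums.

Variables (gT : finGroupType) (S : {group gT}) (F : fusion_system S) (p : nat).
Hypotheses (pS : p.-group S) (satF : saturated F p).
Implicit Types (P Q R : {group gT}) (f g : gT -> gT) (A : {set gT * gT}).
Implicit Types (G H : {group gT * gT}).

Let D := setX_group S S.

Lemma snd_graph (g : gT -> gT) R : @snd gT gT @* graph g R = R.
Proof. by rewrite morphimEsub ?subsetT // -imset_comp /comp imset_id. Qed.

Lemma snd_twist f A : @snd gT gT @* twist f A = @snd gT gT @* A.
Proof. by rewrite !morphimEsub ?subsetT // -imset_comp. Qed.

Lemma graphJ_snd g R s :
  graph (g \o conjg^~ s) R = graph g (R :^ s) :^ (1, s^-1).
Proof.
apply/setP=> -[x y]; rewrite mem_conjg.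
have -> : (x, y) ^ (1, s^-1)^-1 = (x ^ 1^-1, y ^ s^-1^-1) by [].
by rewrite !mem_graph /= invg1 conjg1 invgK memJ_conjg.
Qed.

(** A graph of order [k] with domain [R] gets as target the mark of the graph of a map [h] from
    [rep R] onto a fully normalized subgroup. By [graph_congr] the change needed has the
    divisibility that [msum_adjust] requires. The target depends only on the second projection,
    which [twist] preserves: this is stability at order [k]. The added groups have order [k], so
    marks of larger groups do not change. *)
Lemma stable_step X k : stable_above F k X -> 0 < k ->
    (forall c H, (c, H) \in X -> fusion_graph F H) ->
  exists Y, (forall c H, (c, H) \in Y -> fusion_graph F H /\ #|H| = k)
            /\ stable_above F k.-1 (Y ++ X).
Proof.
move=> stX k_gt0 grX; have [rep [repP repJ]] := group_class_repr S.
pose good R h := exists P, [/\ fully_normalized F P, fiso F R P h &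
  {in 'N_S(R), forall t, exists2 s, s \in 'N_S(P)
                                    & {in R, forall y, h (y ^ t) = h y ^ s}}].
have [t tP] : exists t : {group gT} -> int, forall R, R \subset S ->
    exists2 h, good R h & t R = msum D X (graph h R).
  apply: (fin_all_exists (P := fun R v => R \subset S ->
    exists2 h, good R h & v = msum D X (graph h R))) => R.
  have [sRS | _] := boolP (R \subset S); last by exists 0%R.
  have [P nP [h0 isoh0]] := fully_normalized_conj F sRS.
  have [h [isoh h_norm]] := fiso_Aut_Sylow pS satF nP isoh0.
  by exists (msum D X (graph h R)) => _; exists h => //; exists P.
pose T (G : {group gT * gT}) := t (rep [group of @snd gT gT @* G]).
pose L := [seq G : {group gT * gT} <- enum {: {group gT * gT}}
              | fusion_graph F G & #|G| == k].
have LP G : reflect (fusion_graph F G /\ #|G| = k) (G \in L).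
  rewrite mem_filter mem_enum andbT.
  by apply: (iffP andP) => -[grG /eqP].
have Tgraph G g R : G = graph g R :> {set _} -> T G = t (rep R).
  move=> defG; congr (t (rep _)); apply/val_inj; rewrite /= defG.
  exact: snd_graph.
have [||Y YL YT] := @msum_adjust _ D X T L k.
- move=> G /LP[/fusion_graphP[R [g Fg defG]] cardG]; split=> //.
    by rewrite defG (graph_subD Fg).
  have sRS := fhom_dom Fg; have [s Ss def_rep] := repP R.
  have sRsS : R :^ s \subset S by rewrite -(conjGid Ss) conjSg.
  have [|h [P [nP isoh h_norm]] eqt] := tP (rep R); first by rewrite def_rep.
  have Fs : fiso F R (rep R) (conjg^~ s).
    apply: (fiso_fhom (Q := S)); last by rewrite def_rep.
    apply/fhom_conj/conj_homsP; split=> //; exists s => //; split=> //.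
  have isohs : fiso F R P (h \o conjg^~ s).
    apply: (fiso_fhom (fhom_comp Fs.1 isoh.1)).
    by rewrite imset_comp -(fiso_im Fs) (fiso_im isoh).
  have hs_norm : {in 'N_S(R), forall t0, exists2 s0, s0 \in 'N_S(P)
      & {in R, forall y, (h \o conjg^~ s) (y ^ t0) = (h \o conjg^~ s) y ^ s0}}.
    move=> x Nx; have [|s0 Ns0 eqs0] := h_norm (x ^ s).
      by rewrite def_rep -{1}(conjGid Ss) /= normJ -conjIg memJ_conjg.
    exists s0 => // y Ry /=; rewrite conjJg eqs0 // def_rep.
    by rewrite memJ_conjg.
  have cardR : #|R| = k by rewrite -cardG defG card_graph.
  have := graph_congr satF stX cardR Fg nP isohs hs_norm.
  rewrite graphJ_snd msumJ; last by apply/setXP; rewrite group1 groupV.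
  rewrite (Tgraph G g R) // eqt def_rep -defG -opprB rpredN //.
- move=> G H /LP[/fusion_graphP[R [g Fg defG]] _] /LP[grH _] [s1 s2] /setXP[_ Ss2] defH.
  rewrite (Tgraph G g R) // -(repJ R s2) //; congr (t (rep _)).
  apply/val_inj; rewrite /= defH defG morphimJ ?inE //.
  by rewrite snd_graph.
exists Y; split=> [c H /YL/LP // | P f A Ff sAP ltkA].
have gen_tw := twist_gen Ff sAP; have sAP' : <<A>> \subset setX P S by rewrite gen_subG.
have card_tw : #|<<twist f A>>| = #|<<A>>| by rewrite gen_tw (card_twist Ff).
have grYX c H : (c, H) \in Y ++ X -> fusion_graph F H.
  by rewrite mem_cat => /orP[/YL/LP[] | /grX].
have m0 B : ~~ fusion_graph F <<B>> -> msum D (Y ++ X) B = 0%R.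
  move=> notgr; apply: msum_eq0 => c H d YXH Dd; apply: contra notgr => sBH.
  apply: (@fusion_graph_sub _ _ _ _ (H :^ d)%G); first by rewrite gen_subG.
  by apply: fusion_graphJ (grYX c H YXH).
have [ltk | lek] := ltnP k #|<<A>>|.
  rewrite !msum_cat (stX P f A) //.
  have Y0 B : k < #|<<B>>| -> msum D Y B = 0%R.
    move=> ltB; apply: msum_eq0 => c H d YH _; have [_ cardH] := LP _ (YL c H YH).
    apply: contraL ltB => sBH; rewrite -leqNgt -cardH -(cardJg H d) subset_leq_card //.
    by rewrite gen_subG.
  by rewrite !Y0 // card_tw.
have eqk : #|<<A>>| = k by apply/eqP; rewrite eqn_leq lek -(prednK k_gt0).
(* If [<<A>>] is not the graph of a morphism, neither is its twist, and both marks vanish. *)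
have [grA | notgrA] := boolP (fusion_graph F <<A>>); last first.
  rewrite !m0 // gen_tw; apply: contra notgrA.
  exact: fusion_graph_twist_inv Ff sAP'.
have grfA : fusion_graph F <<twist f A>> by rewrite gen_tw (fusion_graph_twist Ff).
rewrite -msum_gen -[RHS]msum_gen.
rewrite (YT [group of <<twist f A>>]) ?(YT [group of <<A>>]).
- by congr (t (rep _)); apply/val_inj; rewrite /= gen_tw snd_twist.
- by apply/LP.
by apply/LP; rewrite /= card_tw.
Qed.

End StableSums.

(** * The stable virtual biset *)

(** [a] permutes each coset of ['Phi(S)], whose size is prime to [q], so it fixes a point there; its
    fixed points and ['Phi(S)] generate [S], hence the fixed points alone are all of [S]. *)
Lemma Aut_Frattini_trivial (gT : finGroupType) (S : {group gT}) (p q : nat)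
    (a : {perm gT}) :
    p.-group S -> prime q -> q != p -> a \in Aut S -> q.-elt a ->
    {in S, forall x, x^-1 * a x \in 'Phi(S)} -> a = 1.
Proof.
move=> pS q_pr neq_qp Aa qa aPhi.
pose C := [set x in S | a x == x].
have gC : group_set C.
  apply/group_setP; split=> [|x y].
    by rewrite inE group1 -(autmE Aa) morph1 eqxx.
  case/setIdP=> Sx /eqP ax /setIdP[Sy /eqP ay].
  by rewrite inE groupM // -(autmE Aa) morphM //= !autmE ax ay eqxx.
have sPhi := Phi_sub S.
suffices defS : 'Phi(S) <*> Group gC = S.
  have := Phi_nongen defS; rewrite genGid => eqC.
  apply: (eq_Aut Aa (group1 _)) => x; rewrite -eqC perm1 => /setIdP[_ /eqP//].
have sCS : C \subset S by apply/subsetP=> x /setIdP[].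
apply/eqP; rewrite eqEsubset join_subG sPhi sCS /=.
apply/subsetP=> x Sx; pose Y := x *: 'Phi(S).
have sYS : Y \subset S by rewrite mul_subG ?sub1set.
have actY : [acts <[a]>, on Y | 'P].
  rewrite cycle_subG !inE; apply/subsetP=> y; rewrite inE !mem_lcoset => Yy.
  have Sy : y \in S by rewrite (subsetP sYS) // mem_lcoset.
  by rewrite /= apermE -(mulKVg y (a y)) mulgA groupM // aPhi.
have := pgroup_fix_mod qa actY; rewrite card_lcoset => eqmod.
have : #|'Fix_(Y | 'P)(<[a]>)| != 0.
  apply: contra neq_qp => /eqP eq0; rewrite eq0 mod0n in eqmod.
  have : q %| #|'Phi(S)| by rewrite /dvdn eqmod.
  apply: (pgroupP (pgroupS sPhi pS)) q_pr.
rewrite -lt0n => /card_gt0P[y /setIP[Yy]]; rewrite afix_cycle => /afix1P ay.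
have Cy : y \in C by rewrite inE (subsetP sYS) //=; apply/eqP.
have Phiy : y^-1 * x \in 'Phi(S) by rewrite -groupV invMg invgK -mem_lcoset.
by rewrite -(mulKVg y x) groupM // mem_gen // inE ?Phiy // Cy orbT.
Qed.

Section StableSumExists.

Variables (gT : finGroupType) (S : {group gT}) (F : fusion_system S) (p : nat).
Hypotheses (pS : p.-group S) (satF : saturated F p).
Implicit Types (P Q R : {group gT}) (f g : gT -> gT) (A : {set gT * gT}).
Implicit Types (G H : {group gT * gT}).

Let D := setX_group S S.

(** Aut_F(S) is generated by its Sylow [p]-subgroup, the inner automorphisms, and by [q]-elements
    with [q != p]; the latter act trivially modulo ['Phi(S)], hence are trivial. *)
Lemma fhom_SS_conj f : focal_residual F p 'Phi(S) -> F S S f ->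
  exists2 s, s \in S & {in S, f =1 conjg^~ s}.
Proof.
move=> resPhi Ff; have [a Fa eqa] := fhom_perm Ff.
have nS := fully_normalized_full F.
have [_] := satF.1 S nS; rewrite faut_conj // => sylA.
pose G := Group (faut_group_set F (subxx S)).
have : G \subset conj_aut S @* 'N_S(S).
  apply: (@Sylow_primeelt_gen _ p G _ (conj_aut S @* 'N_S(S))%G) sylA _ _ => //.
  move=> q b q_pr neq_qp Gb qb; have /setIdP[Ab _] : b \in faut F S := Gb.
  suffices -> : b = 1 by apply: group1.
  exact: (Aut_Frattini_trivial pS q_pr neq_qp Ab qb (resPhi _ _ _ q_pr neq_qp Gb qb)).
move/subsetP/(_ a Fa)/morphimP=> [s nSs /setIP[Ss _] def_a].
by exists s => // x Sx; rewrite -eqa // def_a norm_conj_autE.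
Qed.

(** The coset space of the diagonal [G] is [S] as a biset. A subgroup of order at least [#|S|]
    fixing a point is a conjugate of [G], so its first projection is all of [S]. Thus both marks
    vanish unless [P = S], in which case [f] is inner and [twist f] is conjugation by [(s, 1)]. *)
Lemma stable_base (G : {group gT * gT}) : G = graph id S :> {set _} ->
    (forall f, F S S f -> exists2 s, s \in S & {in S, f =1 conjg^~ s}) ->
  stable_above F #|S|.-1 [:: (1%R, G)].
Proof.
move=> defG FSS P f A Ff sAP; rewrite prednK ?cardG_gt0 // => leSA.
rewrite /msum !big_seq1 /=; congr (_ * Posz _)%R.
have [fP deffP] := fhom_group Ff; have injf := fhom_injective Ff.
have full Q B : #|S| <= #|<<B>>| -> B \subset setX Q S -> mark D B G != 0 ->
    S \subset Q.
  move=> leSB sBQ /mark_neq0[[s1 s2] /setXP[/= Ss1 Ss2]]; rewrite -gen_subG => sBG.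
  have defB : <<B>> = G :^ (s1, s2).
    by apply/eqP; rewrite eqEcard sBG cardJg defG card_graph.
  apply/subsetP=> y Sy; have : (y ^ s1^-1, y ^ s1^-1) \in G.
    by rewrite defG mem_graph eqxx andbT groupJ ?groupV.
  rewrite -(memJ_conjg _ (s1, s2)) -defB.
  have -> : (y ^ s1^-1, y ^ s1^-1) ^ (s1, s2) = ((y ^ s1^-1) ^ s1, (y ^ s1^-1) ^ s2) by [].
  have sgBQ : <<B>> \subset setX Q S by rewrite gen_subG.
  by move/(subsetP sgBQ)/setXP => /= []; rewrite conjgKV.
have [eqPS | neqPS] := eqVneq P S.
  rewrite eqPS in Ff sAP; have [s Ss eqf] := FSS f Ff.
  have -> : twist f A = A :^ (s, 1).
    apply: eq_in_imset => -[x y] /(subsetP sAP)/setXP[/= Sx _].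
    have -> : (x, y) ^ (s, 1) = (x ^ s, y ^ 1) by [].
    by rewrite eqf ?conjg1.
  by rewrite markJ //; apply/setXP.
have notSP : ~~ (S \subset P).
  apply: contra neqPS => sSP; rewrite -val_eqE eqEsubset sSP andbT.
  exact: fhom_dom Ff.
have -> : mark D A G = 0.
  by apply: contraNeq notSP; apply: full leSA sAP.
apply: contraNeq notSP => markf.
have sfAQ : twist f A \subset setX fP S.
  apply/subsetP=> _ /imsetP[[x y] /(subsetP sAP)/setXP[/= Px Sy] ->].
  by apply/setXP; rewrite deffP imset_f.
have sAP' : <<A>> \subset setX P S by rewrite gen_subG.
have : S \subset fP.
  by apply: full sfAQ markf; rewrite (twist_gen Ff) // (card_twist Ff).
move/subset_leq_card; rewrite deffP (card_in_imset injf) => leSP.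
by have /eqP -> : P :==: S by rewrite eqEcard leSP (fhom_dom Ff).
Qed.

(** Starting from the diagonal, [stable_step] is applied at the orders from [#|S|.-1] down to 1. All
    added groups are smaller than [S], so the degree, the sum of [c * (#|S| %/ #|H|)], stays 1
    modulo [p]; the shape [rcons Y (1%R, G)] records this. *)
Lemma stable_sum_exists : focal_residual F p 'Phi(S) ->
  exists X, [/\ forall c H, (c, H) \in X -> fusion_graph F H,
    stable_above F 0 X &
    exists Y G, [/\ X = rcons Y (1%R, G), #|G| = #|S| &
                    forall c H, (c, H) \in Y -> #|H| < #|S|]].
Proof.
move=> resPhi; have FSS f := @fhom_SS_conj f resPhi.
have Fid : F S S id by apply: fhom_incl.
pose G := Group (graph_group_set Fid).
have stG := @stable_base G (erefl _) FSS.
have cardG : #|G| = #|S| by apply: card_graph.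
have grG : fusion_graph F G by apply/fusion_graphP; exists S, id.
suffices [Y [grY stY ltY]] : exists Y, [/\ forall c H, (c, H) \in Y -> fusion_graph F H,
    stable_above F 0 (rcons Y (1%R, G)) & forall c H, (c, H) \in Y -> #|H| < #|S|].
  exists (rcons Y (1%R, G)); split=> //; last by exists Y, G.
  by move=> c H; rewrite mem_rcons inE => /predU1P[[_ ->] | /grY].
suffices IH j : exists Y, [/\ forall c H, (c, H) \in Y -> fusion_graph F H,
    stable_above F (#|S|.-1 - j) (rcons Y (1%R, G))
    & forall c H, (c, H) \in Y -> #|H| < #|S|].
  by have := IH #|S|.-1; rewrite subnn.
elim: j => [|j [Y [grY stY ltY]]]; first by exists [::]; rewrite subn0; split.
have [eq0 | j_gt0] := posnP (#|S|.-1 - j).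
  exists Y; split=> //; rewrite subnS eq0 /=; by rewrite eq0 in stY.
have grYG c H : (c, H) \in rcons Y (1%R, G) -> fusion_graph F H.
  by rewrite mem_rcons inE => /predU1P[[_ ->] | /grY].
have [Z [ZP stZ]] := stable_step pS satF stY j_gt0 grYG.
exists (Z ++ Y); split=> [c H||c H].
- by rewrite mem_cat => /orP[/ZP[] | /grY].
- by rewrite rcons_cat subnS.
rewrite mem_cat => /orP[/ZP[_ ->] | /ltY //].
by rewrite -(prednK (cardG_gt0 S)) ltnS leq_subr.
Qed.

End StableSumExists.

(** * Transfer *)

Section TransferPhi.

Variables (gT : finGroupType) (p : nat) (S Q : {group gT}) (u : gT).
Hypotheses (p_pr : prime p) (pS : p.-group S) (sQS : Q \subset S) (Su : u \in S).

Local Notation n x := #|<[u]> : Q :* x|.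

Lemma index_rcoset_eq1 x : (n x == 1%N) = (u ^ x^-1 \in Q).
Proof.
apply/eqP/idP=> [n1 | Qux].
  have := mulg_exp_card_rcosets Q u x; rewrite n1 expg1 mem_rcoset.
  by rewrite conjgE invgK mulgA.
have fixx : Q :* x \in 'Fix_('Rs)(<[u]>).
  by rewrite sub_afixRs_norms cycle_subG mem_conjg.
by rewrite /indexg -orbitRs (orbit1P fixx) cards1.
Qed.

Lemma index_rcoset_modp x : ((n x)%:R = (n x == 1%N)%:R :> 'F_p)%R.
Proof.
have : n x %| #[u] by rewrite /indexg -orbitRs dvdn_orbit.
have pu : p.-nat #[u] by apply: mem_p_elt Su.
move/(pnat_dvd)/(_ pu) => pn; case: eqP => [-> // | /eqP n1].
apply/eqP; rewrite -(dvdn_pcharf (pchar_Fp p_pr)).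
by case/p_natP: pn n1 => // -[|m] ->; rewrite ?expn0 // expnS dvdn_mulr.
Qed.

(** The sum is the transfer of [lam] to [S], expanded over the cycles of [u] on the cosets of [Q].
    The transfer is a homomorphism with elementary abelian image, so it kills ['Phi(S)]. *)
Lemma transfer_Phi (lam : gT -> 'F_p) (X : {set gT}) : u \in 'Phi(S) ->
    {in Q &, forall x y, lam (x * y) = (lam x + lam y)%R} ->
    is_transversal X (rcosets Q S :* <[u]>) S ->
  (\sum_(x in X) lam ((u ^+ n x) ^ x^-1)%g = 0)%R.
Proof.
move=> Phiu lamM trX.
have alphaM : {in Q &, {morph (lam : gT -> 'F_p) : x y / x * y}} by [].
pose alpha := Morphism alphaM.
have abA : abelian (alpha @* Q).
  by apply/centsP=> x _ y _; rewrite /commute !FinRing.zmodMgE addrC.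
have := transfer_cycle_expansion sQS abA Su trX.
set V := transfer S abA.
have V0 : V u = 0%R.
  have Fp0 (x : 'F_p) : x ^+ p = 1.
    by rewrite FinRing.zmodXgE -mulr_natl pchar_Fp_0 // mul0r.
  pose VS := [morphism of V] @* S.
  have abelVS : p.-abelem VS.
    apply/abelemP=> //; split.
      by apply/centsP=> x _ y _; rewrite /commute !FinRing.zmodMgE addrC.
    move=> x _; rewrite FinRing.zmodXgE; apply: FiniteModule.fmod_inj.
    by rewrite FiniteModule.fmvalZ Fp0.
  have : V u \in 'Phi(VS).
    by rewrite -(morphim_Phi _ pS) // mem_morphim.
  by rewrite (eqP (_ : 'Phi(VS) == 1)) ?inE ?(trivg_Phi (abelem_pgroup abelVS)) //
    => /eqP.
rewrite V0 => /(congr1 (@FiniteModule.fmval _ _ _)).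
rewrite FiniteModule.fmval_sum FiniteModule.fmval0 => sum0.
apply: etrans (esym sum0); apply: eq_bigr => x _.
set w := (u ^+ _) ^ _; have Qw : w \in Q.
  by have := mulg_exp_card_rcosets Q u x; rewrite mem_rcoset /w conjgE invgK mulgA.
have Aw : alpha w \in alpha @* Q by apply: mem_morphim.
by rewrite /= (FiniteModule.fmodK abA Aw).
Qed.

End TransferPhi.

Lemma mark_card (gT : finGroupType) (D H : {group gT}) (A : {set gT}) :
  H \subset D -> (mark D A H * #|H|)%N = #|[set d in D | A \subset H :^ d]|.
Proof.
move=> sHD; set E := [set d in D | _]; pose P := 'Fix_(rcosets H D | 'Rs)(A).
have Hrcoset d e : e \in H :* d -> H :^ e = H :^ d.
  by case/rcosetP=> h Hh ->; rewrite conjsgM conjGid.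
rewrite [RHS](card_uniform_partition (n := #|H|) (P := P)) //.
  by move=> _ /mark_fixP[d Dd [-> _]]; rewrite card_rcoset.
have [_ tiP _] := and3P (rcosets_partition sHD).
apply/and3P; split; last 1 first.
- apply/negP=> /mark_fixP[d _ [/setP/(_ d)]].
  by rewrite rcoset_refl inE.
- rewrite eqEsubset; apply/andP; split.
    apply/bigcupsP=> _ /mark_fixP[d Dd [-> sAH]]; apply/subsetP=> e Hde.
    rewrite inE (Hrcoset d e Hde) sAH andbT.
    by case/rcosetP: Hde => h Hh ->; rewrite groupM // (subsetP sHD).
  apply/subsetP=> d /setIdP[Dd sAH]; apply/bigcupP; exists (H :* d).
    by apply/mark_fixP; exists d.
  exact: rcoset_refl.
exact: trivIsetS (subsetIl _ _) tiP.
Qed.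

(** If [E a] holds, [u] fixes the coset [Q :* a], so the block [Q :* a * <[u]>] is just that coset,
    and [E] holds on all of it. *)
Lemma card_cycle_transversal (gT : finGroupType) (S Q : {group gT}) (u : gT)
    (X : {set gT}) (E : pred gT) :
    Q \subset S -> u \in S -> is_transversal X (rcosets Q S :* <[u]>) S ->
    (forall a, a \in S -> E a -> u ^ a^-1 \in Q) ->
    (forall q a, q \in Q -> a \in S -> E (q * a) = E a) ->
  #|[set a in S | E a]| = (#|Q| * #|[set x in X | E x]|)%N.
Proof.
move=> sQS Su trX EQ EM; set XE := [set x in X | E x].
have sXS := transversal_sub trX.
have fixE a y : a \in S -> E a -> y \in Q :* a * <[u]> -> y \in Q :* a.
  move=> Sa Ea; rewrite -!mulgA => /mulsgP[q b Qq].
  rewrite mem_lcoset => /cycleP[i def_b] ->; rewrite mem_rcoset.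
  have def_ba : b * a^-1 = (u ^ a^-1) ^+ i.
    by rewrite -conjXg -def_b conjgE invgK !mulgA mulgV mul1g.
  by rewrite -mulgA groupM // def_ba groupX ?EQ.
have blockP a : a \in S -> Q :* a * <[u]> \in rcosets Q S :* <[u]>.
  by move=> Sa; rewrite mem_mulg ?set11 // -rcosetE imset_f.
rewrite -cardsX -[RHS](card_in_imset (f := fun z => z.1 * z.2)).
  apply: eq_card => a; apply/setIdP/imsetP => [[Sa Ea] | [[q x] /setXP[/= Qq]]].
    have Xx := repr_mem_transversal trX 1 (blockP a Sa).
    have := fixE a _ Sa Ea (repr_mem_pblock trX 1 (blockP a Sa)).
    set x := transversal_repr _ _ _ in Xx * => /rcosetP[q Qq def_x].
    exists (q^-1, x); last by rewrite /= def_x mulKg.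
    by apply/setXP; rewrite groupV Qq inE Xx def_x EM.
  case/setIdP=> Xx Ex ->; have Sx := subsetP sXS x Xx.
  by rewrite groupM ?EM // (subsetP sQS).
move=> [q x] [q' x'] /setXP[/= Qq /setIdP[Xx Ex]]
  /setXP[/= Qq' /setIdP[Xx' Ex']] /= eqm.
suffices eqx : x = x' by rewrite eqx in eqm *; rewrite (mulIg _ _ _ eqm).
have Sx := subsetP sXS x Xx; have blockx := blockP x Sx.
have : x \in X :&: (Q :* x * <[u]>).
  by rewrite inE Xx -{1}[x]mulg1 mem_mulg ?rcoset_refl ?group1.
have : x' \in X :&: (Q :* x * <[u]>).
  rewrite inE Xx' -[x'](mulKg q') -eqm -[_ * _]mulg1 mem_mulg ?group1 //.
  by rewrite mulgA mem_mulg ?set11 ?groupM ?groupV.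
by rewrite (setI_transversal_pblock trX 1 blockx) !inE => /eqP-> /eqP.
Qed.

(** * Fusion invariance of characters of a residual subgroup *)

Section StableHom.

Variables (gT : finGroupType) (S : {group gT}) (F : fusion_system S) (p : nat).
Hypotheses (p_pr : prime p) (pS : p.-group S) (satF : saturated F p).
Implicit Types (P Q R : {group gT}) (f g h : gT -> gT).

Let D := setX_group S S.

Variable K : {group gT}.
Hypotheses (nKS : K <| S) (resK : focal_residual F p K).

Lemma conj_mod_normal P f : F P S f ->
  exists2 s, s \in S & {in P, forall x, (f x)^-1 * x ^ s \in K}.
Proof.
move=> Ff; have [sKS nK] := andP nKS.
have [s Ss eqs] := focal_residual_conj_mod pS satF nK resK Ff.
exists s => // x Px; have Nfx : f x \in 'N(K) by rewrite (subsetP nK) // (fhom_mem Ff).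
have Ns := subsetP nK s Ss; have Nx := subsetP nK x (subsetP (fhom_dom Ff) x Px).
have Nxs : x ^ s \in 'N(K) by rewrite groupJ.
apply: coset_idr; first by rewrite groupM ?groupV.
by rewrite morphM ?morphV ?groupV // morphJ //= eqs // mulVg.
Qed.

Lemma strongly_closed P f x : F P S f -> x \in P -> x \in K -> f x \in K.
Proof.
move=> Ff Px Kx; have [s Ss fsK] := conj_mod_normal Ff.
have Kxs : x ^ s \in K by rewrite memJ_norm // (subsetP (normal_norm nKS)).
by rewrite -groupV -(groupMr _ Kxs) fsK.
Qed.

Variable chi : gT -> 'F_p.
Hypothesis chiM : {in K &, forall x y, chi (x * y) = (chi x + chi y)%R}.
Hypothesis chiJ : {in K & S, forall x s, chi (x ^ s) = chi x}.

Lemma chi1 : chi 1 = 0%R.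
Proof. by apply: (addrI (chi 1)); rewrite -chiM // mulg1 addr0. Qed.

Lemma chiV : {in K, forall x, chi x^-1 = (- chi x)%R}.
Proof.
by move=> x Kx; apply: (addrI (chi x)); rewrite -chiM ?groupV // mulgV chi1 subrr.
Qed.

(** Stability only controls fixed points of pairs; sorting [v] by its value [e] turns a sum of
    values of [chi] into such counts. *)
Definition chi_marks (e : 'F_p) u (H : {group gT * gT}) :=
  (\sum_(v in K | chi v == e) mark D [set (u, v)] H)%N.

Section OneGraph.

Variables (R Q : {group gT}) (h h' : gT -> gT) (H : {group gT * gT}) (u : gT).
Hypotheses (Fh : F R S h) (defQ : Q = h @: R :> {set gT}) (Fh' : F Q R h').
Hypotheses (hK : {in R, cancel h h'}) (h'K : {in Q, cancel h' h}).
Hypothesis (defH : H = graph h R :> {set gT * gT}).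
Hypotheses (Ku : u \in K) (KPhi : K \subset 'Phi(S)).
Hypothesis IHu : forall P f w, F P S f -> w \in P -> w \in K -> #[w] < #[u] ->
  chi (f w) = chi w.

Let E e a := (u ^ a^-1 \in Q) && (chi (h' (u ^ a^-1)) == e).

Let sQS : Q \subset S. Proof. exact: fhom_dom Fh'. Qed.
Let sKS : K \subset S. Proof. exact: normal_sub nKS. Qed.
Let Su : u \in S. Proof. exact: (subsetP sKS). Qed.
Let nKS' s : s \in S -> s \in 'N(K).
Proof. exact: (subsetP (normal_norm nKS)). Qed.

(** Count the pairs [(a, b)] for which [H] contains [(u ^ a^-1, v ^ b^-1)]. Given [a] and [b], the
    only possible [v] is [h' (u ^ a^-1) ^ b], whose value under [chi] does not depend on [b], whence
    the factor [#|S|]. The number of [a] is [#|Q|] times the count over [X], and [#|Q| = #|H|]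
    cancels. *)
Lemma chi_marks_card e (X : {set gT}) :
    is_transversal X (rcosets Q S :* <[u]>) S ->
  chi_marks e u H = (#|S| * #|[set x in X | E e x]|)%N.
Proof.
move=> trX; have sHD : H \subset D by rewrite defH (graph_subD Fh).
have cardH : #|H| = #|Q|.
  by rewrite defH card_graph defQ (card_in_imset (fhom_injective Fh)).
apply/eqP; rewrite -(eqn_pmul2l (cardG_gt0 H)) mulnCA {2}cardH.
rewrite -(card_cycle_transversal sQS Su trX).
- rewrite mulnC /chi_marks big_distrl /=.
  under eq_bigr do rewrite mark_card //.
  have cardE v : #|[set d in D | [set (u, v)] \subset H :^ d]|
      = (\sum_(a in S) \sum_(b in S) ((u ^ a^-1, v ^ b^-1)%g \in H))%N.
    rewrite pair_big_dep /= -sum1_card big_mkcond [RHS]big_mkcond /=.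
    apply: eq_bigr => -[a b] _ /=; rewrite inE sub1set in_setX /= mem_conjg.
    have -> : (u, v) ^ (a, b)^-1 = (u ^ a^-1, v ^ b^-1) by [].
    by case: (a \in S); case: (b \in S); case: (_ \in H).
  under eq_bigr do rewrite cardE.
  rewrite exchange_big /= -[X in (_ * X)%N]sum1_card big_distrr /=.
  rewrite [X in _ == X]big_mkcond /=.
  rewrite big_mkcond /=; apply/eqP; apply: eq_bigr => a _; rewrite inE.
  case: ifP => //= Sa; rewrite exchange_big /=.
  have eqE b : b \in S ->
      (\sum_(v in K | chi v == e) ((u ^ a^-1, v ^ b^-1)%g \in H) = E e a)%N.
    move=> Sb; rewrite (reindex_inj (conjg_inj b)) /=.
    rewrite (eq_bigl (fun v => (v \in K) && (chi v == e))) => [|v]; last first.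
      by rewrite memJ_norm ?nKS' //; apply: andb_id2l => Kv; rewrite chiJ.
    under eq_bigr do rewrite conjgK defH mem_graph.
    have [Ea | notEa] := boolP (E e a).
      have [Qua chie] := andP Ea; have Rw := fhom_mem Fh' Qua.
      have Kw : h' (u ^ a^-1) \in K.
        by rewrite (strongly_closed (fhomS Fh')) // memJ_norm // nKS' ?groupV.
      rewrite (bigD1 (h' (u ^ a^-1))) ?Kw //= Rw h'K // eqxx.
      rewrite big1 // => v /andP[_]; apply: contraNeq; rewrite eqb0 negbK.
      by case/andP=> Rv /eqP->; rewrite hK.
    rewrite big1 // => v /andP[Kv chiv]; apply/eqP; rewrite eqb0.
    apply: contra notEa => /andP[Rv /eqP eqv].
    by rewrite /E eqv hK // chiv defQ imset_f.
  rewrite (eq_bigr (fun=> E e a : nat)) // sum_nat_const.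
  by case: (E e a); rewrite ?muln1 ?muln0.
- by move=> a _ /andP[].
move=> q a Qq Sa; have Sq := subsetP sQS q Qq.
have memq : (u ^ (q * a)^-1 \in Q) = (u ^ a^-1 \in Q).
  by rewrite invMg conjgM memJ_norm // groupV (subsetP (normG Q)).
rewrite /E memq; apply: andb_id2l => Qua.
have Kw : h' (u ^ a^-1) \in K.
  by rewrite (strongly_closed (fhomS Fh')) // memJ_norm // nKS' ?groupV.
rewrite invMg conjgM (fhomJ Fh') ?groupV // chiJ //.
by rewrite (subsetP (fhom_dom Fh)) // (fhom_mem Fh') ?groupV.
Qed.

(** [transfer_Phi] is applied to [lam]. A coset not fixed by [u] contributes [lam] at an element of
    smaller order than [u], which is zero by [IHu]. A fixed coset contributes
    [chi (h' (u ^ x^-1)) - chi u], and modulo [p] there are [#|S : Q|] of these. *)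
Lemma chi_marks_sum :
  (\sum_e e * (chi_marks e u H %/ #|S|)%:R = #|S : Q|%:R * chi u)%R.
Proof.
pose X := transversal (rcosets Q S :* <[u]>) S.
have trX : is_transversal X (rcosets Q S :* <[u]>) S.
  by apply: transversalP; apply: rcosets_cycle_partition.
have sXS := transversal_sub trX.
pose n x := #|<[u]> : Q :* x|.
transitivity (\sum_(x in X | n x == 1%N) chi (h' (u ^ x^-1)%g))%R.
  rewrite (partition_big (fun x => chi (h' (u ^ x^-1))) xpredT) //=.
  apply: eq_bigr => e _; rewrite (chi_marks_card e trX) mulKn ?cardG_gt0 //.
  rewrite (eq_bigr (fun=> e)) => [|x /andP[_ /eqP//]].
  rewrite sumr_const mulr_natr; congr (_ *+ _)%R; rewrite -sum1_card -[RHS]sum1_card.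
  by apply: eq_bigl => x; rewrite inE [RHS]unfold_in /n index_rcoset_eq1 andbA.
have [s Ss hsK] := conj_mod_normal Fh.
pose mu y := y^-1 * h' y ^ s; pose lam y := chi (mu y).
have Kmu y : y \in Q -> mu y \in K.
  by move=> Qy; rewrite /mu -{1}(h'K Qy) hsK // (fhom_mem Fh').
have lamM : {in Q &, forall y z, lam (y * z) = (lam y + lam z)%R}.
  move=> y z Qy Qz; have Sz := subsetP sQS z Qz.
  (* [mu (y * z) = mu y ^ z * mu z], and [chi] does not see the conjugation by [z]. *)
  rewrite /lam -(chiJ (Kmu y Qy) Sz) -chiM ?Kmu //; last first.
    by rewrite memJ_norm ?Kmu ?nKS'.
  congr chi; rewrite /mu (fhomM Fh') // conjMg invMg !conjgE !mulgA.
  by rewrite !mulgK.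
have lamK y : y \in Q -> y \in K -> lam y = (chi (h' y) - chi y)%R.
  move=> Qy Ky; have Kh'y := strongly_closed (fhomS Fh') Qy Ky.
  by rewrite /lam /mu chiM ?groupV ?memJ_norm ?nKS' // chiV // chiJ // addrC.
have := transfer_Phi p_pr pS sQS Su (subsetP KPhi u Ku) lamM trX.
rewrite (bigID (fun x => n x == 1%N)) /= [X in (_ + X)%R]big1 => [|x].
  rewrite addr0 (eq_bigr (fun x => chi (h' (u ^ x^-1)%g) - chi u)%R) => [|x].
    rewrite big_split /= sumrN => /eqP; rewrite subr_eq0 => /eqP->.
    rewrite -(sum_index_rcosets_cycle sQS Su trX) natr_sum mulr_suml big_mkcondr /=.
    apply: eq_bigr => x Xx; rewrite (index_rcoset_modp _ p_pr pS Su) -/(n x).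
    by case: eqP => _; rewrite ?mul1r ?mul0r.
  case/andP=> Xx n1; rewrite -/(n x) (eqP n1) expg1; have Sx := subsetP sXS x Xx.
  have Qux : u ^ x^-1 \in Q by rewrite -index_rcoset_eq1.
  by rewrite lamK ?chiJ ?groupV // memJ_norm // nKS' ?groupV.
case/andP=> Xx n1; have Sx := subsetP sXS x Xx.
set w := (u ^+ _) ^ _; have Qw : w \in Q.
  by have := mulg_exp_card_rcosets Q u x; rewrite mem_rcoset /w conjgE invgK mulgA.
have Kw : w \in K by rewrite memJ_norm ?groupX // nKS' ?groupV.
rewrite lamK // (IHu (fhomS Fh')) ?subrr // orderJ.
have dvdn : n x %| #[u] by rewrite /n /indexg -orbitRs dvdn_orbit.
rewrite orderXdiv // ltn_Pdiv ?order_gt0 // ltn_neqAle eq_sym n1.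
exact: dvdn_gt0 (order_gt0 u) dvdn.
Qed.

End OneGraph.

Lemma stable_hom P f u : K \subset 'Phi(S) -> focal_residual F p 'Phi(S) ->
  F P S f -> u \in P -> u \in K -> chi (f u) = chi u.
Proof.
move=> KPhi resPhi; have [n] := ubnP #[u]; elim: n P f u => // n IHn P f u.
rewrite ltnS => leun Ff Pu Ku.
have [X [grX stX [Y [G [defX cardG ltY]]]]] := stable_sum_exists pS satF resPhi.
(* [N e v] is an integer because stability concerns [#|S| * N e v], and [#|S|] must be cancelled
   before reduction modulo [p]. *)
pose N e v : int := (\sum_(x <- X) x.1 * (chi_marks e v x.2 %/ #|S|)%:Z)%R.
have sKS := normal_sub nKS.
suffices chiN v : v \in K -> #[v] <= n ->
    (chi v = \sum_e e * (N e v)%:~R)%R /\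
    forall e, (#|S|%:Z * N e v = \sum_(w in K | chi w == e) msum D X [set (v, w)])%R.
  have Kfu := strongly_closed Ff Pu Ku.
  have [|-> Nfu] := chiN (f u) Kfu; first by rewrite (fhom_order Ff).
  have [//|-> Nu] := chiN u Ku.
  apply: eq_bigr => e _; congr (_ * _%:~R)%R.
  have S_neq0 : (#|S|%:Z != 0)%R by rewrite -lt0n cardG_gt0.
  apply: (mulfI S_neq0); rewrite Nfu Nu; apply: eq_bigr => w /andP[Kw _].
  have -> : [set (f u, w)] = twist f [set (u, w)] by rewrite /twist imset_set1.
  apply: stX Ff _ _; last exact: cardG_gt0.
  by rewrite sub1set; apply/setXP; rewrite Pu (subsetP sKS).
move=> Kv lev.
have graphX c H : (c, H) \in X -> exists R Q h h', [/\ F R S h,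
    Q = h @: R :> {set gT}, F Q R h', {in R, cancel h h'} & {in Q, cancel h' h}]
    /\ H = graph h R :> {set _}.
  move=> /grX/fusion_graphP[R [h Fh defH]]; have [Q defQ] := fhom_group Fh.
  by have [h' [Fh' hK h'K]] := fhom_inverse Fh defQ; exists R, Q, h, h'.
have IHv Q g w : F Q S g -> w \in Q -> w \in K -> #[w] < #[v] -> chi (g w) = chi w.
  by move=> Fg Qw Kw ltw; apply: IHn Fg Qw Kw; apply: leq_trans ltw lev.
split=> [|e].
  (* The degree of [X] is 1 modulo [p]: the diagonal contributes 1, every other entry a multiple of
     a proper index in [S]. *)
  transitivity (\sum_(x <- X) x.1%:~R * ((#|S| %/ #|x.2|)%:R * chi v))%R.
    rewrite defX -cats1 big_cat big_seq1 /= cardG divnn cardG_gt0 !mul1r big_seq.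
    rewrite big1 ?add0r // => -[c H] YH /=.
    have XH : (c, H) \in X by rewrite defX mem_rcons inE YH orbT.
    have [R [Q [h [h' [[Fh _ _ _ _] defH]]]]] := graphX c H XH.
    have ltRS := ltY c H YH; rewrite defH card_graph in ltRS *.
    have sRS := fhom_dom Fh; rewrite divgS //.
    have : p %| #|S : R|.
      have [m eqm] := p_natP (pnat_dvd (dvdn_indexg S R) pS).
      move: eqm; case: m => [|m ->]; last by rewrite expnS dvdn_mulr.
      by move/eqP; rewrite expn0 indexg_eq1 => /subset_leq_card; rewrite leqNgt ltRS.
    by rewrite (dvdn_pcharf (pchar_Fp p_pr)) => /eqP->; rewrite mul0r mulr0.
  rewrite /N; under [RHS]eq_bigr do rewrite rmorph_sum /= mulr_sumr.
  rewrite exchange_big /= big_seq [RHS]big_seq; apply: eq_bigr => -[c H] XH /=.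
  have [R [Q [h [h' [[Fh defQ Fh' hK h'K] defH]]]]] := graphX c H XH.
  have eqQ : #|S| %/ #|H| = #|S : Q|.
    rewrite -divgS ?(fhom_dom Fh') // defH card_graph.
    by rewrite [in RHS]defQ (card_in_imset (fhom_injective Fh)).
  rewrite eqQ -(chi_marks_sum Fh defQ Fh' hK h'K defH Kv KPhi IHv) mulr_sumr.
  by apply: eq_bigr => e _; rewrite rmorphM /= mulrCA.
rewrite /N mulr_sumr /msum exchange_big /= big_seq [RHS]big_seq.
apply: eq_bigr => -[c H] XH /=; rewrite mulrCA -mulr_sumr; congr (_ * _)%R.
have [R [Q [h [h' [[Fh defQ Fh' hK h'K] defH]]]]] := graphX c H XH.
have trX : is_transversal (transversal (rcosets Q S :* <[v]>) S)
             (rcosets Q S :* <[v]>) S.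
  apply: transversalP; apply: rcosets_cycle_partition (subsetP sKS v Kv).
  exact: fhom_dom Fh'.
rewrite -PoszM -(big_morph Posz PoszD (erefl _)) -/(chi_marks e v H).
by rewrite (chi_marks_card Fh defQ Fh' hK h'K defH Kv e trX) mulKn ?cardG_gt0.
Qed.

End StableHom.

(** * First cohomology and the descent *)

(** [chi] is the discrete logarithm to a generator [y] of the cyclic group [K / M], read modulo
    [p]. *)
Lemma index_prime_hom (gT : finGroupType) (K M : {group gT}) p :
    prime p -> M <| K -> #|K : M| = p ->
  exists2 chi : gT -> 'F_p,
    {in K &, forall x y, chi (x * y) = (chi x + chi y)%R} &
    {in K, forall x, (chi x == 0%R) = (x \in M)}.
Proof.
move=> p_pr nMK indexM; have [sMK nM] := andP nMK.
have oKM : #|K / M| = p by rewrite card_quotient.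
have /cyclicP[y defKM] : cyclic (K / M) by rewrite prime_cyclic ?oKM.
have oy : #[y] = p by rewrite -oKM defKM.
(* The default is reached only outside [K / M]. *)
pose log z := odflt 0 (omap val [pick i : 'I_#[y] | y ^+ i == z]).
have logK z : z \in K / M -> y ^+ log z = z.
  rewrite defKM /log => /cyclePmin[i lti ->].
  by case: pickP => [j /eqP //| /(_ (Ordinal lti))]; rewrite eqxx.
have qK x : x \in K -> coset M x \in K / M by apply: mem_quotient.
have FpE (i j : nat) : (i%:R == j%:R :> 'F_p)%R = (y ^+ i == y ^+ j).
  by rewrite eq_expg_mod_order oy -!val_eqE /= !val_Fp_nat.
exists (fun x => (log (coset M x))%:R)%R => [x x' Kx Kx' | x Kx].
  apply/eqP; rewrite -natrD FpE expgD !logK ?qK ?groupM // morphM //.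
    exact: (subsetP nM). exact: (subsetP nM).
rewrite -[0%R]/(0%:R)%R FpE expg0 logK ?qK //.
by apply/eqP/idP => [/coset_idr-> // | /coset_id //]; apply: (subsetP nM).
Qed.

Section FirstCohomology.

Variables (p : nat) (gT : finGroupType) (S : {group gT}) (F : fusion_system S).
Variable chi : gT -> 'F_p.
Hypothesis chiM : {in S &, forall x y, chi (x * y) = (chi x + chi y)%R}.

(** The homogeneous 1-cocycle attached to the homomorphism [chi]. *)
Definition hom_cochain : cochain p (subg_of S) 1 :=
  [ffun g : {ffun 'I_2 -> subg_of S} => chi (sgval ((g ord0)^-1 * g ord_max))].

Lemma hom_cochain_cocycle : hom_cochain \in @is_cocycle p (subg_of S) 1.
Proof.
apply/andP; split.
  apply/forallP=> x; apply/forallP=> g; rewrite !ffunE invMg -mulgA mulKg //.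
apply/eqP/ffunP=> g; rewrite ffunE !big_ord_recl big_ord0 !ffunE /=.
pose o1 : 'I_3 := lift ord0 ord0; pose o2 : 'I_3 := lift ord0 (lift ord0 ord0).
rewrite (_ : lift ord0 ord_max = o2); last exact/val_inj.
rewrite (_ : lift o1 ord0 = ord0); last exact/val_inj.
rewrite (_ : lift o1 ord_max = o2); last exact/val_inj.
rewrite (_ : lift o2 ord0 = ord0); last exact/val_inj.
rewrite (_ : lift o2 ord_max = o1); last exact/val_inj.
rewrite -/o1 expr0 expr1 mul1r mulN1r sqrrN expr1n mul1r addr0.
have -> : (sgval (g ord0))^-1 * sgval (g o2) =
    (sgval (g ord0))^-1 * sgval (g o1) * ((sgval (g o1))^-1 * sgval (g o2)).
  by rewrite mulgA mulgK.
rewrite [X in (_ + (- X + _))%R]chiM ?groupM ?groupV ?subgP //.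
by rewrite opprD addrA [(_ + (_ + _))%R]addrCA subrr addr0 addNr.
Qed.

(** With trivial coefficients an invariant 0-cochain is constant, so 1-coboundaries vanish and equal
    classes give equal cocycles, which are compared at [(1, x)]. *)
Lemma stable_class_hom P f x :
    (forall z : cohomology p (subg_of S) 1, @Defs.stable p gT S F 1 z) ->
  F P S f -> x \in P -> chi (f x) = chi x.
Proof.
move=> stz Ff Px; pose c := Cocycle hom_cochain_cocycle.
have homM (h : gT -> gT) : F P S h -> {morph @hom_to gT S P h : y z / y * z}.
  move=> Fh y z; rewrite /hom_to morphM ?(fhomM Fh) ?subgP //.
  by rewrite subgM ?(fhom_mem Fh) ?subgP.
have Fid := fhom_incl F (fhom_dom Ff) (subxx S).
have := stz (\pi_(cohomology p (subg_of S) 1)%qT c) P f Ff.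
rewrite (cohomology_pull_pi (homM id Fid)) (cohomology_pull_pi (homM f Ff)).
move/eqP; rewrite -Quotient.idealrBE unfold_in /coboundary raddfB /=.
case/existsP=> b /andP[/forallP invb /eqP/ffunP eqb].
pose g := [ffun i : 'I_2 => if i == ord0 then 1 else subg P x].
have b_const (g1 g2 : {ffun 'I_1 -> subg_of P}) : b g1 = b g2.
  have /forallP/(_ g2)/eqP <- := invb (g1 ord0 * (g2 ord0)^-1).
  by congr (b _); apply/ffunP=> i; rewrite !ffunE ord1 mulgKV.
have db0 : differential b g = 0%R.
  rewrite ffunE !big_ord_recl big_ord0 expr0 mul1r expr1 mulN1r addr0.
  by apply/eqP; rewrite subr_eq0; apply/eqP/b_const.
have := eqb g; rewrite db0 !ffunE /= /hom_to /=.
have Sx := subsetP (fhom_dom Ff) x Px; have Sfx := fhom_mem Ff Px.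
rewrite (fhom1 Ff) !subgK // invg1 !mul1g => /eqP.
by rewrite subr_eq0 => /eqP.
Qed.

End FirstCohomology.

(** * Descent from the Frattini subgroup to the trivial subgroup *)

Section Tate.

Variables (p : nat) (gT : finGroupType) (S : {group gT}) (F : fusion_system S).
Hypotheses (p_pr : prime p) (pS : p.-group S) (satF : saturated F p).

(** A maximal subgroup of the [p]-group [S] is the kernel of a homomorphism to ['F_p], which is
    [F]-invariant, so it contains [x^-1 * a x]; ['Phi(S)] is the intersection of these kernels. *)
Lemma focal_residual_Phi :
    (forall z : cohomology p (subg_of S) 1, @Defs.stable p gT S F 1 z) ->
  focal_residual F p 'Phi(S).
Proof.
move=> stz P q a _ _ /setIdP[_ Fa] _ x Px.
have [Sx Sax] : x \in S /\ a x \in S.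
  by rewrite (subsetP (fhom_dom Fa)) // (fhom_mem (fhomS Fa)).
apply/bigcapP=> M; case/predU1P=> [-> | maxM]; first by rewrite groupM ?groupV.
have nMS := p_maximal_normal pS maxM.
have [chi chiM chi0] := index_prime_hom p_pr nMS (p_maximal_index pS maxM).
have chi1 : chi 1 = 0%R by apply/eqP; rewrite chi0.
rewrite -chi0 ?groupM ?groupV // chiM ?groupV //.
rewrite (stable_class_hom chiM stz (fhomS Fa) Px) -chiM ?groupV // mulVg chi1.
exact: eqxx.
Qed.

(** Since [M] is normal in [S] and of index [p] in [K], the quotient [K / M] is central in the
    [p]-group [S / M]; so [chi] is [S]-invariant, and [stable_hom] makes it [F]-invariant. *)
Lemma focal_residual_descent (K : {group gT}) :
    focal_residual F p 'Phi(S) -> K <| S -> K \subset 'Phi(S) ->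
    focal_residual F p K -> K :!=: 1 ->
  exists M : {group gT}, [/\ M <| S, M \proper K & focal_residual F p M].
Proof.
move=> resPhi nKS KPhi resK ntK; have sKS := normal_sub nKS.
have pK := pgroupS sKS pS; have [_ _ [m oK]] := pgroup_pdiv pK ntK.
have [|M [sMK nMS oM]] := @normal_pgroup p gT m S K pS nKS.
  by rewrite oK pfactorK.
have nMK : M <| K by apply: normalS nMS.
have indexM : #|K : M| = p.
  by rewrite -divgS // oK oM expnS mulnK // expn_gt0 prime_gt0.
have [chi chiM chi0] := index_prime_hom p_pr nMK indexM.
have nMS' := normal_norm nMS.
have cenK : K / M \subset 'Z(S / M).
  have oKM : #|K / M| = p by rewrite card_quotient ?normal_norm.
  have nilSM : nilpotent (S / M) by apply: pgroup_nil (quotient_pgroup _ pS).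
  have ntKM : K / M != 1 by rewrite trivg_card1 oKM; apply: contraTneq p_pr => ->.
  have := meet_center_nil nilSM (quotient_normal M nKS) ntKM.
  by apply: contraR => /(prime_TIg _) ->; rewrite ?oKM.
have chi1 : chi 1 = 0%R by apply/eqP; rewrite chi0.
have chi_eq x y : x \in K -> y \in K -> x^-1 * y \in M -> chi y = chi x.
  move=> Kx Ky; rewrite -chi0 ?groupM ?groupV // => /eqP chixy.
  by rewrite -(mulKVg x y) chiM ?groupM ?groupV // chixy addr0.
have chiJ : {in K & S, forall x s, chi (x ^ s) = chi x}.
  move=> x s Kx Ss; have Nx := subsetP nMS' x (subsetP sKS x Kx).
  have Ns := subsetP nMS' s Ss.
  have Kxs : x ^ s \in K by rewrite memJ_norm // (subsetP (normal_norm nKS)).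
  apply: chi_eq => //; apply: coset_idr; first by rewrite groupM ?groupV ?groupJ.
  have cxs : commute (coset M x) (coset M s).
    have /centerP[_] := subsetP cenK _ (mem_quotient M Kx).
    by apply; apply: mem_quotient.
  rewrite morphM ?groupV ?groupJ // morphV // morphJ //.
  by rewrite /= conjgE cxs mulKg mulVg.
have stab P f u := @stable_hom gT S F p p_pr pS satF K nKS resK chi chiM chiJ
                     P f u KPhi resPhi.
exists M; split=> //.
  by rewrite properEcard sMK oM oK /= ltn_exp2l ?prime_gt1.
move=> P q a q_pr neq_qp Fa qa x Px.
have /setIdP[Aa Fa'] := Fa; have Fas := fhomS Fa'.
have aX n : {in P, a ^+ n =1 iter n a} by move=> y _; rewrite permX.
pose w := x^-1 * a x; have Kw : w \in K := resK P q a q_pr neq_qp Fa qa x Px.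
have Pax y : y \in P -> a y \in P by apply: (fhom_mem Fa').
have Pw : w \in P by rewrite groupM ?groupV ?Pax.
have iterPK n : iter n a w \in P /\ iter n a w \in K /\ chi (iter n a w) = chi w.
  elim: n => //= n [Pn [Kn chin]]; rewrite Pax // (stab P a) //; split=> //.
  split=> //; exact: (strongly_closed pS satF nKS resK Fas).
have chi_iter n : x^-1 * iter n a x \in K /\ chi (x^-1 * iter n a x) = (chi w *+ n)%R.
  elim: n => [|n [Kn chin]]; first by rewrite mulVg.
  have [_ [Kwn chiwn]] := iterPK n.
  have -> : x^-1 * iter n.+1 a x = x^-1 * iter n a x * iter n a w.
    have An := groupX n Aa; rewrite iterSr -!aX ?Pax // -!(autmE An).
    by rewrite morphM ?morphV ?groupV ?Pax // mulgA mulgK.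
  by rewrite groupM // chiM // chin chiwn mulrSr.
(* Taking [n = #[a]] gives [chi w *+ #[a] = 0], and [p] does not divide the [q]-power [#[a]]. *)
have [_] := chi_iter #[a]; rewrite -aX // expg_order perm1 mulVg chi1.
move/esym/eqP.
rewrite -mulr_natr mulf_eq0 orbC -(dvdn_pcharf (pchar_Fp p_pr)) => /orP[p_dv_a | ].
  case/negP: neq_qp; have := pnat_dvd p_dv_a qa.
  by rewrite pnatE // => /eqP ->.
by rewrite chi0.
Qed.

Lemma focal_residual1 : focal_residual F p 'Phi(S) -> focal_residual F p 1.
Proof.
move=> resPhi; have nPhi : 'Phi(S) <| S by apply: Phi_normal.
suffices IH n (K : {group gT}) : #|K| <= n -> K <| S -> K \subset 'Phi(S) ->
    focal_residual F p K -> focal_residual F p 1.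
  exact: (IH _ 'Phi(S)%G (leqnn _)).
elim: n K => [|n IHn] K; first by rewrite leqNgt cardG_gt0.
move=> leKn nKS KPhi resK; have [K1 | ntK] := eqVneq (K : {set gT}) 1.
  by have -> : 1%G = K by apply/val_inj.
have [M [nMS ltMK resM]] := focal_residual_descent resPhi nKS KPhi resK ntK.
apply: IHn nMS (subset_trans (proper_sub ltMK) KPhi) resM.
by rewrite -ltnS (leq_trans (proper_card ltMK)).
Qed.

End Tate.

Theorem corollary1p4 (p : nat) (gT : finGroupType) (S : {group gT})
    (F : fusion_system S) :
  prime p -> (p.-group S)%g -> saturated F p ->
  bijective (@fusion_res p gT S F 1%N) ->
  eq_fusion F (conj_fusion S).
Proof.
move=> p_pr pS satF [g _ resK].
(* The inverse [g] exhibits each class as the image of a stable class. *)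
have stz (z : cohomology p (subg_of S) 1) : @Defs.stable p gT S F 1 z.
  by rewrite -(resK z); apply: svalP.
have res1 := focal_residual1 p_pr pS satF (focal_residual_Phi p_pr pS stz).
move=> P Q f; apply/idP/idP => [Ff | ]; last exact: fhom_conj.
(* Conjugation modulo the trivial subgroup is genuine conjugation. *)
have [s Ss eqs] := conj_mod_normal pS satF (normal1 S) res1 (fhomS Ff).
have eqf : {in P, f =1 conjg^~ s}.
  move=> x Px; apply: (mulgI (f x)^-1); rewrite mulVg.
  by have := eqs x Px; rewrite inE => /eqP.
apply/conj_homsP; split; [exact: fhom_dom Ff | exact: fhom_cod Ff |].
exists s => //; split=> //; apply/subsetP=> _ /imsetP[x Px ->].
by rewrite -eqf // (fhom_mem Ff).
Qed.
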